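(* Let $A$ be a finite set with $|A|\geq 5$. Then the degenerate RTA $Deg(A)$, i.e. the RTA generated by $B_1(A)$, is a maximal borrow closed RTA and a maximal ancilla closed RTA.
   Context: For a finite set $A$ and $n\geq 1$, $B_n(A)=\operatorname{Sym}(A^n)$ and $B(A)=\bigcup_{n} B_n(A)$. For $\alpha\in S_n$ the wire permutation $\pi_\alpha\in B_n(A)$ is $\pi_\alpha(x_1,\dots,x_n)=(x_{\alpha^{-1}(1)},\dots,x_{\alpha^{-1}(n)})$; $\Pi$ is the set of all wire permutations of all arities; $i_n\in B_n(A)$ is the identity. For $f\in B_n(A)$, $g\in B_m(A)$, the parallel composition $f\oplus g\in B_{n+m}(A)$ applies $f$ to the first $n$ coordinates and $g$ to the last $m$ coordinates. The serial composition $f\bullet g$ is composition in $\operatorname{Sym}(A^n)$ when $f,g$ have the same arity $n$; if the arities differ, the one of smaller arity is first padded on the right by an identity (e.g. $f\bullet g=(f\oplus i_{m-n})\bullet g$ if $n<m$). A reversible Toffoli algebra (RTA) on $A$ is a subset $C\subseteq B(A)$ containing $\Pi$ and closed under $\oplus$ and $\bullet$. Write $C^{[n]}=C\cap B_n(A)$. The RTA generated by $F\subseteq B(A)$ is the smallest RTA containing $F$. An RTA $C$ is borrow closed if for all $f\in B(A)$, $f\oplus i_1\in C$ implies $f\in C$. An RTA $C$ is ancilla closed if for all $n$ and $f\in B_n(A)$: whenever there are $g\in C^{[n+1]}$ and $a\in A$ such that for all $x_1,\dots,x_n\in A$ we have $f_i(x_1,\dots,x_n)=g_i(x_1,\dots,x_n,a)$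 for $i=1,\dots,n$ and $g_{n+1}(x_1,\dots,x_n,a)=a$, then $f\in C$. A maximal borrow (respectively ancilla) closed RTA is a borrow (resp. ancilla) closed RTA $M\subsetneq B(A)$ such that no borrow (resp. ancilla) closed RTA $N$ satisfies $M\subsetneq N\subsetneq B(A)$. *)

(* Defs.v *)
From mathcomp Require Import all_boot all_fingroup all_algebra.
From mathcomp Require Import boolp classical_sets.

Set Implicit Arguments.
Unset Strict Implicit.
Unset Printing Implicit Defensive.

Local Open Scope classical_set_scope.

Section Gates.

Variable A : finType.

(* A^n is the type 'rV[A]_n of row vectors over the mere set A, so that row_mx
   is concatenation and lsubmx, rsubmx are the initial and final segments. *)
Definition Bn (n : nat) := {perm 'rV[A]_n}.

Definition id_gate (n : nat) : Bn n := 1%g.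

(* col_perm s x has j-th coordinate x_(s j), whence the inverse. *)
Lemma wire_inj n (s : 'S_n) : injective (fun x : 'rV[A]_n => col_perm s^-1%g x).
Proof.
by apply: (can_inj (g := col_perm s)) => x; rewrite -col_permM mulgV col_perm1.
Qed.

Definition wire n (s : 'S_n) : Bn n := perm (@wire_inj n s).

Definition par_fun n m (f : Bn n) (g : Bn m) (x : 'rV[A]_(n + m)) :
    'rV[A]_(n + m) :=
  row_mx (f (lsubmx x)) (g (rsubmx x)).

Lemma par_fun_inj n m (f : Bn n) (g : Bn m) : injective (par_fun f g).
Proof.
move=> x y /eq_row_mx[/perm_inj el /perm_inj er].
by rewrite -[x]hsubmxK -[y]hsubmxK el er.
Qed.

Definition par n m (f : Bn n) (g : Bn m) : Bn (n + m) :=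
  perm (@par_fun_inj n m f g).

(* The type transport along n + (N - n) = N does not move any coordinate. *)
Definition pad n N (le_nN : n <= N) (f : Bn n) : Bn N :=
  ecast k (Bn k) (subnKC le_nN) (par f (id_gate (N - n))).

(* (s * t) x = t (s x) in MathComp, so this is the map x |-> f (g x). *)
Definition ser n m (f : Bn n) (g : Bn m) : Bn (maxn n m) :=
  (pad (leq_maxr n m) g * pad (leq_maxl n m) f)%g.

(* Permutations of A^n for some n, including n = 0; the latter are excluded
   from Ball, which is B(A), and hence from every reversible Toffoli algebra. *)
Definition gate := {n : nat & Bn n}.

Definition Gate n (f : Bn n) : gate := existT Bn n f.

Definition Ball : set gate := [set f | 0 < tag f].

Definition Barity (n : nat) : set gate := [set f | tag f = n].

Definition wires : set gate :=
  [set f | exists n (s : 'S_n), 0 < n /\ f = Gate (wire s)].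

Definition is_RTA (C : set gate) : Prop :=
  [/\ C `<=` Ball,
      wires `<=` C,
      forall n m (f : Bn n) (g : Bn m),
        C (Gate f) -> C (Gate g) -> C (Gate (par f g)) &
      forall n m (f : Bn n) (g : Bn m),
        C (Gate f) -> C (Gate g) -> C (Gate (ser f g))].

Definition RTA_generated (F : set gate) : set gate := smallest is_RTA F.

Definition Deg : set gate := RTA_generated (Barity 1).

Definition borrow_closed (C : set gate) : Prop :=
  forall n (f : Bn n), 0 < n -> C (Gate (par f (id_gate 1))) -> C (Gate f).

(* The first n coordinates of 'I_(n + 1) are the lshift 1 i, the last one is
   rshift n ord0. *)
Definition ancilla_closed (C : set gate) : Prop :=
  forall n (f : Bn n), 0 < n ->
    (exists (g : Bn (n + 1)) (a : A),
       C (Gate g) /\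
       forall x : 'rV[A]_n,
         let y := g (row_mx x (const_mx a)) in
         (forall i : 'I_n, f x ord0 i = y ord0 (lshift 1 i)) /\
         y ord0 (rshift n ord0) = a) ->
    C (Gate f).

Definition maximal_RTA (P : set gate -> Prop) (M : set gate) : Prop :=
  [/\ is_RTA M, P M, M `<` Ball &
      ~ exists N : set gate, [/\ is_RTA N, P N, M `<` N & N `<` Ball]].

Definition maximal_borrow_closed_RTA : set gate -> Prop :=
  maximal_RTA borrow_closed.

Definition maximal_ancilla_closed_RTA : set gate -> Prop :=
  maximal_RTA ancilla_closed.

End Gates.

Arguments id_gate A n : clear implicits.
Arguments Ball A : clear implicits.
Arguments Barity A n : clear implicits.
Arguments wires A : clear implicits.
Arguments Deg A : clear implicits.

(* Main.v *)
Require Import Defs.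
From mathcomp Require Import boolp classical_sets.
From mathcomp Require Import all_boot all_fingroup all_algebra.
From mathcomp Require Import zify.

(** The gates of Deg(A) turn out to be the degenerate ones, those each of whose
    outputs depends on at most one input.  Read this way, Deg(A) is visibly
    ancilla closed and proper; and an ancilla closed RTA is borrow closed.  So
    both assertions reduce to one: a borrow closed RTA that contains Deg(A) and
    a nondegenerate gate [f] contains every gate.

    Let [G n] be the group of its gates of arity n, a group of permutations of
    A^n that contains Sym(A)^n and the wire permutations.  The aim is to show
    that [G n] contains the alternating group of A^n for all large n.

    - [seed_of_nondegenerate].  Conjugating unary transpositions by [f], or by
      such a conjugate, gives a gate [h] that fixes pointwise some line (all
      wires but one, [y], are frozen) and yet changes the wire [y] somewhere.
      Indeed a transposition of two letters that an output does not take on a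
      line leaves that line alone; there is a line on which some output takes at
      most three values, so that five letters leave two of them free.

    - [two_transitive].  Comparing a moved point with the points of a fixed line,
      [h] merges the G-orbits of pairs at Hamming distances w and w + 1, away
      from the extremes.  A nondegenerate gate is no isometry, and this implies
      both that it increases some distance 1 and that it decreases some maximal
      distance; so the extreme distances are merged with the middle ones and
      [G n] is 2-transitive for large n.

    - [small_support_gates].  A commutator of two gates that share only the wire
      [y] is trivial on every line that one of the two fixes pointwise.  Repeated
      commutators therefore shrink the proportion of moved points
      geometrically; [pivot] is the condition that keeps them nontrivial.

    - [small_support_tri], [tri_even].  In a 2-transitive group, averaging the
      overlap of the support of [h] with its conjugates (an argument of Bochert)
      turns an element of support at most 1/8 of the points into a 3-cycle, and
      then all even permutations follow.

    Parity is the last obstacle.  Padding a gate of arity n by further wires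
    makes it even when |A| is even; when |A| is odd, [G n] contains an odd padded
    unary gate.  Either way every gate, once padded, lies in the RTA, and borrow
    closedness removes the padding. *)

Set Implicit Arguments.
Unset Strict Implicit.
Unset Printing Implicit Defensive.

Local Open Scope group_scope.

(** * Placing a gate on chosen wires *)

Section Ext.
Variable A : finType.
Implicit Types (n k m : nat).

Definition rowf n (F : 'I_n -> A) : 'rV[A]_n := (\row_j F j)%R.

Lemma rowfE n (F : 'I_n -> A) i : rowf F ord0 i = F i.
Proof. by rewrite mxE. Qed.

Lemma row_eqP n (x y : 'rV[A]_n) : (forall i, x ord0 i = y ord0 i) -> x = y.
Proof. by move=> exy; apply/rowP. Qed.

(** A gate acts on chosen wires by reading them ([sub]) and writing its result
    back ([ins]); the list [e] of wires need not be increasing or consecutive. *)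
Definition sub k n (e : 'I_k -> 'I_n) (x : 'rV[A]_n) : 'rV[A]_k :=
  rowf (fun j => x ord0 (e j)).

Definition ins k n (e : 'I_k -> 'I_n) (x : 'rV[A]_n) (z : 'rV[A]_k) :=
  rowf (fun i => if [pick j | e j == i] is Some j then z ord0 j else x ord0 i).

Lemma ins_out k n (e : 'I_k -> 'I_n) x z i :
  (forall j, e j != i) -> ins e x z ord0 i = x ord0 i.
Proof.
move=> out; rewrite rowfE; case: pickP => // j /eqP eji.
by have := out j; rewrite eji eqxx.
Qed.

Section Inj.
Variables (k n : nat) (e : 'I_k -> 'I_n).
Hypothesis e_inj : injective e.

Lemma ins_in x z j : ins e x z ord0 (e j) = z ord0 j.
Proof.
rewrite rowfE; case: pickP => [j' /eqP/e_inj -> // | /(_ j)].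
by rewrite eqxx.
Qed.

Lemma sub_ins x z : sub e (ins e x z) = z.
Proof. by apply: row_eqP => j; rewrite rowfE ins_in. Qed.

Lemma ins_sub x : ins e x (sub e x) = x.
Proof.
apply: row_eqP => i; rewrite rowfE; case: pickP => // j /eqP <-.
by rewrite rowfE.
Qed.

Lemma ins_ins x z z' : ins e (ins e x z) z' = ins e x z'.
Proof.
apply: row_eqP => i; rewrite rowfE; case: pickP => [j /eqP <-|no].
  by rewrite ins_in.
by rewrite !ins_out // => j; rewrite no.
Qed.

Lemma ext_inj (g : {perm 'rV[A]_k}) :
  injective (fun x => ins e x (g (sub e x))).
Proof.
move=> x y exy; have /perm_inj sxy: g (sub e x) = g (sub e y).
  by rewrite -(sub_ins x (g (sub e x))) exy sub_ins.
have := congr1 (fun u => ins e u (sub e x)) exy.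
by rewrite !ins_ins ins_sub sxy ins_sub.
Qed.

Definition ext (g : {perm 'rV[A]_k}) : {perm 'rV[A]_n} := perm (@ext_inj g).

Lemma extE g x : ext g x = ins e x (g (sub e x)).
Proof. by rewrite permE. Qed.

Lemma ext_in g x j : ext g x ord0 (e j) = g (sub e x) ord0 j.
Proof. by rewrite extE ins_in. Qed.

Lemma ext_out g x i : (forall j, e j != i) -> ext g x ord0 i = x ord0 i.
Proof. by move=> out; rewrite extE ins_out. Qed.

Lemma extM f g : ext (f * g) = ext f * ext g.
Proof.
apply/permP => x; rewrite permM !extE permM.
by rewrite sub_ins ins_ins.
Qed.

Lemma ext1 : ext 1 = 1.
Proof. by apply/permP => x; rewrite extE !perm1 ins_sub. Qed.

Lemma extV g : ext g^-1 = (ext g)^-1.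
Proof. by apply/eqP; rewrite eq_sym eq_invg_mul -extM mulgV ext1. Qed.

End Inj.

Lemma ext_ext k n m (e : 'I_k -> 'I_n) (e' : 'I_n -> 'I_m) (e'' : 'I_k -> 'I_m)
    (i : injective e) (i' : injective e') (i'' : injective e'') g :
  e'' =1 e' \o e -> ext i'' g = ext i' (ext i g).
Proof.
move=> ee; apply/permP => x; apply: row_eqP => l.
have se : sub e'' x = sub e (sub e' x).
  by apply: row_eqP => j; rewrite !rowfE ee.
have [/existsP[j /eqP <-]|/existsPn no] := boolP [exists j, e'' j == l].
  by rewrite ext_in ee /= ext_in ext_in se.
rewrite ext_out //.
have [/existsP[j /eqP jl]|/existsPn no'] := boolP [exists j, e' j == l].
  rewrite -jl ext_in ext_out ?rowfE // => j'.
  by apply/eqP => ej; have := no j'; rewrite ee /= ej jl eqxx.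
by rewrite ext_out.
Qed.

Lemma widen_inj n m (le_nm : n <= m) : injective (widen_ord le_nm).
Proof. by move=> i j /(congr1 val) /= /val_inj. Qed.

Lemma const_inj n (i : 'I_n) : injective (fun _ : 'I_1 => i).
Proof. by move=> j k _; rewrite !ord1. Qed.

Lemma par_id_ext n d (f : Bn A n) :
  par f (id_gate A d) = ext (@lshift_inj n d) f.
Proof.
apply/permP => x; apply: row_eqP => i; rewrite permE /par_fun.
rewrite -[i]splitK; case: (fintype.split i) => j /=.
  rewrite row_mxEl ext_in; congr (f _ ord0 j).
  by apply: row_eqP => l; rewrite !mxE.
rewrite row_mxEr perm1 mxE ext_out // => l.
by rewrite eq_lrshift.
Qed.

Lemma ext_lshift_row_mx n d (f : Bn A n) x z :
  ext (@lshift_inj n d) f (row_mx x z) = row_mx (f x) z.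
Proof.
by rewrite -par_id_ext permE /par_fun row_mxKl row_mxKr perm1.
Qed.

(** This removes the arity casts once and for all: padding is placement on the
    initial wires. *)
Lemma pad_ext n N (le_nN : n <= N) (f : Bn A n) :
  pad le_nN f = ext (@widen_inj _ _ le_nN) f.
Proof.
rewrite /pad; move: (subnKC le_nN) => e.
move: (N - n)%N e le_nN => d e; case: N / e => le_nN.
rewrite par_id_ext; apply/permP => x; rewrite !extE.
have ee : lshift d =1 widen_ord le_nN by move=> j; apply: val_inj.
have -> : sub (lshift d) x = sub (widen_ord le_nN) x.
  by apply: row_eqP => j; rewrite !rowfE ee.
apply: row_eqP => i; rewrite !rowfE.
by under eq_pick => j do rewrite ee.
Qed.

Lemma ext_bij_id n (e : 'I_n -> 'I_n) (e_inj : injective e) (f : Bn A n) :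
  e =1 id -> ext e_inj f = f.
Proof.
move=> ee; apply/permP => x; apply: row_eqP => i.
rewrite -{1}[i]ee ext_in; congr (f _ ord0 i).
by apply: row_eqP => j; rewrite rowfE ee.
Qed.

Lemma pad_nn n (f : Bn A n) (le : n <= n) : pad le f = f.
Proof. by rewrite pad_ext ext_bij_id // => i; apply: val_inj. Qed.

(** As an untyped gate, a padding depends on its target arity only, not on the
    way in which this arity is written. *)
Lemma Gate_pad_irr n N N' (le : n <= N) (le' : n <= N') (f : Bn A n) :
  N = N' -> Gate (pad le f) = Gate (pad le' f).
Proof. by move=> e; case: N' / e le' => le'; rewrite (bool_irrelevance le le'). Qed.

Lemma wireE n (s : 'S_n) (x : 'rV[A]_n) i :
  wire A s x ord0 i = x ord0 (s^-1 i).
Proof. by rewrite permE mxE. Qed.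

End Ext.

Arguments const_inj {n} i.

(** * Unary gates and the permutation groups of an RTA *)

(** Induction on the lists: once the tails are matched, a transposition brings
    the first point to its place without disturbing them. *)
Lemma perm_map_uniq (T : finType) (s t : seq T) :
  uniq s -> uniq t -> size s = size t -> exists p : {perm T}, map p s = t.
Proof.
elim: s t => [|x s IHs] [|y t] //=; first by exists 1.
move=> /andP[xs us] /andP[yt ut] [/(IHs _ us ut)[p pst]].
exists (p * tperm (p x) y); rewrite permM tpermL; congr cons.
rewrite -[RHS]pst; apply/eq_in_map => z zs; rewrite permM tpermD //.
  by rewrite (inj_eq perm_inj); apply: contraNneq xs => ->.
by apply: contraNneq yt => ->; rewrite -pst map_f.
Qed.

Section Unary.
Variable A : finType.

(** The line through [x] in the direction of the wire [i] is the set of points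
    [upd i b x], for [b] in [A]. *)
Definition upd n (i : 'I_n) (b : A) (x : 'rV[A]_n) : 'rV[A]_n :=
  rowf (fun j => if j == i then b else x ord0 j).

Lemma upd_in n (i : 'I_n) b x : upd i b x ord0 i = b.
Proof. by rewrite rowfE eqxx. Qed.

Lemma upd_out n (i j : 'I_n) b x : j != i -> upd i b x ord0 j = x ord0 j.
Proof. by rewrite rowfE => /negPf ->. Qed.

Lemma upd_id n (i : 'I_n) (x : 'rV[A]_n) : upd i (x ord0 i) x = x.
Proof. by apply: row_eqP => j; rewrite rowfE; case: eqP => [->|]. Qed.

Lemma upd_upd n (i : 'I_n) b c x : upd i b (upd i c x) = upd i b x.
Proof. by apply: row_eqP => j; rewrite !rowfE; case: eqP. Qed.

Lemma at_wire_inj n (i : 'I_n) (u : {perm A}) :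
  injective (fun x : 'rV[A]_n => upd i (u (x ord0 i)) x).
Proof.
move=> x y e; apply: row_eqP => j; case: (eqVneq j i) => [->|ji].
  by apply: (@perm_inj _ u); have := congr1 (fun z : 'rV[A]_n => z ord0 i) e; rewrite !upd_in.
by have := congr1 (fun z : 'rV[A]_n => z ord0 j) e; rewrite !upd_out.
Qed.

Definition at_wire n (i : 'I_n) (u : {perm A}) : {perm 'rV[A]_n} :=
  perm (@at_wire_inj n i u).

Lemma at_wireE n (i : 'I_n) u x : at_wire i u x = upd i (u (x ord0 i)) x.
Proof. by rewrite permE. Qed.

Lemma at_wire_upd n (i : 'I_n) u b x : at_wire i u (upd i b x) = upd i (u b) x.
Proof. by rewrite at_wireE upd_in upd_upd. Qed.

Lemma at_wire_in n (i : 'I_n) u x : at_wire i u x ord0 i = u (x ord0 i).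
Proof. by rewrite at_wireE upd_in. Qed.

Lemma at_wire_out n (i j : 'I_n) u x : j != i -> at_wire i u x ord0 j = x ord0 j.
Proof. by move=> ji; rewrite at_wireE upd_out. Qed.

Lemma at_wireV n (i : 'I_n) u : (at_wire i u)^-1 = at_wire i u^-1.
Proof.
apply/eqP; rewrite eq_invg_mul; apply/eqP/permP => x.
by rewrite permM perm1 !at_wireE upd_in permK upd_upd upd_id.
Qed.

Lemma at_wire_ext n (i : 'I_n) u : at_wire i u = ext (const_inj i) (at_wire ord0 u).
Proof.
apply/permP => x; apply: row_eqP => j; case: (eqVneq j i) => [->|ji].
  by have /= -> := ext_in (const_inj i) (at_wire ord0 u) x ord0; rewrite !at_wire_in rowfE.
by rewrite at_wire_out // ext_out // => _; rewrite eq_sym.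
Qed.

End Unary.

Section Closed.
Variable A : finType.

(** All that the argument needs of an RTA, in terms of groups: its gates of each
    arity form a group, they may be placed on any distinct wires of a larger
    arity, and unary gates and wire permutations are among them. *)
Record gate_clone := GateClone {
  clone_grp :> forall n, {group {perm 'rV[A]_n}};
  clone_ext : forall k n (e : 'I_k -> 'I_n) (e_inj : injective e) g,
    g \in clone_grp k -> ext e_inj g \in clone_grp n;
  clone_at_wire : forall n (i : 'I_n) u, at_wire i u \in clone_grp n;
  clone_wire : forall n (s : 'S_n), wire A s \in clone_grp n
}.

Section OfRTA.
Variable C : set (gate A).
Hypothesis C_RTA : is_RTA C.
Hypothesis C1 : (Barity A 1 `<=` C)%classic.

Lemma RTA_wire n (s : 'S_n) : 0 < n -> C (Gate (wire A s)).
Proof. by case: C_RTA => _ w _ _ n_gt0; apply: w; exists n, s. Qed.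

Lemma wire1 n : wire A (1 : 'S_n) = 1.
Proof.
by apply/permP => x; apply: row_eqP => i; rewrite wireE invg1 !perm1.
Qed.

Lemma RTA_mul n (f g : Bn A n) : C (Gate f) -> C (Gate g) -> C (Gate (f * g)).
Proof.
case: C_RTA => _ _ _ ser_C Cf Cg; have := ser_C _ _ _ _ Cg Cf.
suff -> : Gate (ser g f) = Gate (f * g) by [].
rewrite /ser; move: (leq_maxl n n) (leq_maxr n n); rewrite maxnn => l r.
by rewrite !pad_nn.
Qed.

Lemma RTA_pad n N (le_nN : n <= N) (f : Bn A n) :
  0 < n -> C (Gate f) -> C (Gate (pad le_nN f)).
Proof.
move=> n0 Cf; have N0 : 0 < N by apply: leq_trans le_nN.
case: C_RTA => _ _ _ ser_C; have := ser_C _ _ _ _ Cf (RTA_wire 1 N0).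
suff -> : Gate (ser f (wire A (1 : 'S_N))) = Gate (pad le_nN f) by [].
rewrite /ser wire1; move/maxn_idPr: (le_nN) => e.
move: (leq_maxl n N) (leq_maxr n N); rewrite e => l r.
by rewrite pad_nn mul1g (bool_irrelevance l le_nN).
Qed.

(** An injective choice of wires is the inclusion of the initial wires followed by
    a wire permutation, so [ext e_inj g] is a conjugate of a padding of [g]. *)
Lemma RTA_ext k n (e : 'I_k -> 'I_n) (e_inj : injective e) (g : Bn A k) :
  0 < k -> C (Gate g) -> C (Gate (ext e_inj g)).
Proof.
move=> k0 Cg; have le_kn : k <= n by rewrite -[k]card_ord -[n]card_ord (leq_card _ e_inj).
have n0 : 0 < n by apply: leq_trans le_kn.
have [s se] : exists s : 'S_n, forall j, s (widen_ord le_kn j) = e j.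
  have uw : uniq (map (widen_ord le_kn) (enum 'I_k)).
    by rewrite map_inj_uniq ?enum_uniq //; apply: widen_inj.
  have ue : uniq (map e (enum 'I_k)) by rewrite map_inj_uniq ?enum_uniq.
  have [|s se] := perm_map_uniq uw ue; first by rewrite !size_map.
  exists s => j; move: se; rewrite -map_comp => /eq_in_map; apply.
  by rewrite mem_enum.
suff -> : ext e_inj g = wire A s^-1 * pad le_kn g * wire A s.
  apply: RTA_mul; last exact: RTA_wire.
  by apply: RTA_mul; [exact: RTA_wire | exact: RTA_pad].
rewrite pad_ext; apply/permP => x; apply: row_eqP => i.
rewrite !permM wireE.
have [/existsP[j /eqP <-]|/existsPn no] := boolP [exists j, e j == i].
  rewrite ext_in -[in RHS]se permK ext_in; congr (g _ ord0 j).
  by apply: row_eqP => l; rewrite !rowfE wireE invgK se.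
rewrite ext_out // ext_out ?wireE ?invgK ?permKV // => j.
by apply/eqP => ej; have := no j; rewrite -se ej permKV eqxx.
Qed.

(** In arity 0 an RTA has no gate at all; adding the trivial permutation of the
    one-point set A^0 there makes the family a group in every arity. *)
Definition RTA_set n : {set {perm 'rV[A]_n}} :=
  [set g | (n == 0)%N || `[< C (Gate g) >]].

Lemma RTA_setP n (g : Bn A n) : 0 < n -> reflect (C (Gate g)) (g \in RTA_set n).
Proof. by move=> n0; rewrite inE gtn_eqF //; apply: asboolP. Qed.

Lemma RTA_group_set n : group_set (RTA_set n).
Proof.
case: (posnP n) => [->|n0]; first by apply/group_setP; split=> [|f g _ _]; rewrite inE.
apply/group_setP; split=> [|f g]; first by apply/(RTA_setP _ n0); rewrite -wire1; apply: RTA_wire.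
by move=> /(RTA_setP _ n0) Cf /(RTA_setP _ n0) Cg; apply/(RTA_setP _ n0)/RTA_mul.
Qed.

Canonical RTA_group n := Group (RTA_group_set n).

Lemma rV0_perm1 (g : {perm 'rV[A]_0}) : g = 1.
Proof. by apply/permP => x; apply: row_eqP => -[]. Qed.

Lemma RTA_clone_ext k n (e : 'I_k -> 'I_n) (e_inj : injective e) g :
  g \in RTA_group k -> ext e_inj g \in RTA_group n.
Proof.
case: (posnP k) => [k0|k0].
  by subst k; rewrite (rV0_perm1 g) ext1 group1.
have n0 : 0 < n.
  by apply: leq_trans k0 _; rewrite -[k]card_ord -[n]card_ord (leq_card _ e_inj).
by move=> /(RTA_setP _ k0) Cg; apply/(RTA_setP _ n0)/RTA_ext.
Qed.

Lemma RTA_clone_at_wire n (i : 'I_n) u : at_wire i u \in RTA_group n.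
Proof.
rewrite at_wire_ext; apply: RTA_clone_ext; apply/RTA_setP => //.
exact: C1.
Qed.

Lemma RTA_clone_wire n (s : 'S_n) : wire A s \in RTA_group n.
Proof.
case: (posnP n) => n0; first by rewrite inE; apply/orP; left; apply/eqP.
exact/(RTA_setP _ n0)/RTA_wire.
Qed.

Definition RTA_clone : gate_clone :=
  GateClone RTA_clone_ext RTA_clone_at_wire RTA_clone_wire.

End OfRTA.
End Closed.

(** * Degenerate gates *)

Section Degen.
Variable A : finType.

Definition degenerate n (f : {perm 'rV[A]_n}) :=
  forall i, exists j, forall x y : 'rV[A]_n, x ord0 j = y ord0 j -> f x ord0 i = f y ord0 i.

Lemma degenerateM n (f g : {perm 'rV[A]_n}) :
  degenerate f -> degenerate g -> degenerate (f * g).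
Proof.
move=> df dg i; have [j dj] := dg i; have [k dk] := df j.
by exists k => x y /dk fxy; rewrite !permM; apply: dj.
Qed.

Lemma degenerate_wire n (s : 'S_n) : degenerate (wire A s).
Proof. by move=> i; exists (s^-1 i) => x y e; rewrite !wireE. Qed.

Lemma degenerate_ext k n (e : 'I_k -> 'I_n) (e_inj : injective e) g :
  degenerate g -> degenerate (ext e_inj g).
Proof.
move=> dg i; have [/existsP[l /eqP <-]|/existsPn no] := boolP [exists l, e l == i].
  have [j dj] := dg l; exists (e j) => x y exy; rewrite !ext_in; apply: dj.
  by rewrite !rowfE.
by exists i => x y exy; rewrite !ext_out.
Qed.

Lemma degenerate_par n m (f : Bn A n) (g : Bn A m) :
  degenerate f -> degenerate g -> degenerate (par f g).
Proof.
move=> df dg i; rewrite -[i]splitK; case: (fintype.split i) => l /=.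
  have [j dj] := df l; exists (lshift m j) => x y exy.
  by rewrite !permE /par_fun !row_mxEl; apply: dj; rewrite !mxE.
have [j dj] := dg l; exists (rshift n j) => x y exy.
by rewrite !permE /par_fun !row_mxEr; apply: dj; rewrite !mxE.
Qed.

Definition degenerate_gates : set (gate A) :=
  [set f | 0 < tag f /\ degenerate (tagged f)].

Lemma degenerate_RTA : is_RTA degenerate_gates.
Proof.
split=> [f [] //|f [n [s [n0 ->]]]|n m f g [n0 df] [m0 dg]|n m f g [n0 df] [m0 dg]].
- by split=> //; apply: degenerate_wire.
- by split; [rewrite /= addn_gt0 n0 | apply: degenerate_par].
- split=> /=; first by rewrite leq_max n0.
  by rewrite /ser !pad_ext; apply: degenerateM; apply: degenerate_ext.
Qed.

Lemma degenerate_arity1 : (Barity A 1 `<=` degenerate_gates)%classic.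
Proof.
move=> [n f] /= n1; rewrite /Barity /= in n1; subst n; split=> // i; exists ord0 => x y exy.
by have -> : x = y by apply: row_eqP => k; rewrite (ord1 k).
Qed.

Lemma Deg_degenerate : (Deg A `<=` degenerate_gates)%classic.
Proof. by move=> f; apply; split; [apply: degenerate_RTA | apply: degenerate_arity1]. Qed.

Lemma Deg_arity1 : (Barity A 1 `<=` Deg A)%classic.
Proof. by move=> f f1 C [_ C1]; apply: C1. Qed.

Lemma Deg_RTA : is_RTA (Deg A).
Proof.
split=> [f /Deg_degenerate[] //|f wf C [[_ CW _ _] _]|n m f g Df Dg C CP|n m f g Df Dg C CP].
- exact: CW.
- by case: (CP) => [[_ _ Cpar _] _]; apply: Cpar; [apply: Df | apply: Dg].
- by case: (CP) => [[_ _ _ Cser] _]; apply: Cser; [apply: Df | apply: Dg].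
Qed.

Hypothesis A2 : 2 <= #|A|.

Lemma other (b : A) : exists c, c != b.
Proof.
have /card_gt0P[c] : 0 < #|predC1 b| by rewrite cardC1; lia.
by rewrite !inE => ?; exists c.
Qed.

Lemma prod_actE n (u : 'I_n -> {perm A}) (s : seq 'I_n) x j : uniq s ->
  (\prod_(i <- s) at_wire i (u i)) x ord0 j = if j \in s then u j (x ord0 j) else x ord0 j.
Proof.
elim: s x => [|i s IHs] x /=; first by rewrite big_nil perm1.
move=> /andP[iNs us]; rewrite big_cons permM IHs // inE.
have [->|ji] /= := eqVneq j i; first by rewrite (negPf iNs) at_wire_in.
by rewrite at_wire_out.
Qed.

(** No wire can be ignored by all outputs, since [f] is injective; so the map from
    outputs to the inputs they depend on is onto, hence a permutation of the
    wires.  Then each output is an injective function of its input, and [f] is a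
    wire permutation followed by unary gates. *)
Lemma degenerate_clone (G : gate_clone A) n (f : {perm 'rV[A]_n}) :
  degenerate f -> f \in G n.
Proof.
move=> /choice[s sP].
have /card_gt0P[a0 _] : 0 < #|A| by lia.
pose x0 := rowf (fun _ : 'I_n => a0).
have /choice[r rP] : forall j, exists i, s i = j.
  move=> j; apply: contrapT => no; have [b ba] := other a0.
  have : f x0 = f (upd j b x0).
    apply: row_eqP => i; apply: sP; rewrite upd_out //.
    by apply/eqP => sj; apply: no; exists i.
  move/perm_inj/(congr1 (fun x : 'rV[A]_n => x ord0 j)); rewrite upd_in rowfE => e.
  by rewrite e eqxx in ba.
have r_inj : injective r by apply: (can_inj rP).
pose p := perm r_inj; have pE j : p j = r j by rewrite permE.
have ps i : p^-1 i = s i.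
  have rpi : r (p^-1 i) = i by rewrite -pE permKV.
  by rewrite -{2}rpi rP.
have s_inj : injective s by move=> i i'; rewrite -!ps => /perm_inj.
pose U i b := f (upd (s i) b x0) ord0 i.
have fU x i : f x ord0 i = U i (x ord0 (s i)) by apply: sP; rewrite upd_in.
have U_inj i : injective (U i).
  move=> b b' Ub; have : f (upd (s i) b x0) = f (upd (s i) b' x0).
    apply: row_eqP => k; have [->//|ki] := eqVneq k i.
    by apply: sP; rewrite !upd_out ?(inj_eq s_inj).
  by move/perm_inj/(congr1 (fun x : 'rV[A]_n => x ord0 (s i))); rewrite !upd_in.
have -> : f = wire A p * \prod_(i <- enum 'I_n) at_wire i (perm (@U_inj i)).
  apply/permP => x; apply: row_eqP => i.
  by rewrite permM prod_actE ?enum_uniq // mem_enum permE wireE ps fU.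
rewrite groupM ?clone_wire // big_seq group_prod // => i _; exact: clone_at_wire.
Qed.

Lemma Deg_E n (f : Bn A n) : Deg A (Gate f) <-> 0 < n /\ degenerate f.
Proof.
split=> [/Deg_degenerate // | [n0 df]]; apply/(RTA_setP _ _ n0).
exact: (degenerate_clone (RTA_clone Deg_RTA Deg_arity1)).
Qed.

(** If an output of [f] came from the ancilla wire it would be constant, and then
    it depends on no input at all. *)
Lemma Deg_ancilla : ancilla_closed (Deg A).
Proof.
move=> n f n0 [g [a [/Deg_E[_ dg] fg]]]; apply/Deg_E; split=> // i.
have [j dj] := dg (lshift 1 i).
have fE x : f x ord0 i = g (row_mx x (const_mx a)) ord0 (lshift 1 i) by have [-> _] := fg x.
move: dj; rewrite -[j]splitK; case: (fintype.split j) => k /= dj.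
  by exists k => x y exy; rewrite !fE; apply: dj; rewrite !row_mxEl.
by exists i => x y exy; rewrite !fE; apply: dj; rewrite !row_mxEr.
Qed.

Lemma ancilla_borrow (C : set (gate A)) : ancilla_closed C -> borrow_closed C.
Proof.
move=> aC n f n0 Cf; have /card_gt0P[a _] : 0 < #|A| by lia.
apply: aC => //; exists (par f (id_gate A 1)), a; split=> // x /=.
rewrite permE /par_fun row_mxKl row_mxKr perm1.
by split=> [i|]; rewrite ?row_mxEl // row_mxEr mxE.
Qed.

(** On two wires, exchanging the points (a,a) and (a,b) makes the second output
    depend on both inputs. *)
Lemma Deg_proper : (Deg A `<` Ball A)%classic.
Proof.
split; first by have [] := Deg_RTA.
have /card_gt0P[a _] : 0 < #|A| by lia.
have [b ba] := other a => DB.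
pose pt (c d : A) := rowf (fun i : 'I_2 => if i == ord0 then c else d).
pose f : Bn A 2 := tperm (pt a a) (pt a b).
have /Deg_E[_ /(_ ord_max)[j dj]] : Deg A (Gate f) by apply: DB.
have ptE c d c' d' : (pt c d == pt c' d') = (c == c') && (d == d').
  apply/eqP/andP => [e|[/eqP-> /eqP->] //].
  have := congr1 (fun x : 'rV[A]_2 => x ord0 ord0) e.
  have := congr1 (fun x : 'rV[A]_2 => x ord0 ord_max) e.
  by rewrite !rowfE /= => -> ->.
have faa : f (pt a a) ord0 ord_max = b by rewrite tpermL rowfE.
have fab : f (pt a b) ord0 ord_max = a by rewrite tpermR rowfE.
have fba : f (pt b a) ord0 ord_max = a.
  by rewrite tpermD ?rowfE // ptE ![a == b]eq_sym (negPf ba).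
have [j0|j1] := eqVneq j ord0.
  have := dj (pt a a) (pt a b); rewrite !rowfE j0 eqxx faa fab => /(_ erefl) e.
  by rewrite e eqxx in ba.
have := dj (pt a a) (pt b a); rewrite !rowfE (negPf j1) faa fba => /(_ erefl) e.
by rewrite e eqxx in ba.
Qed.

End Degen.

(** * Lines and Hamming distance *)

Section Hamming.
Variable A : finType.

Definition hdist n (x y : 'rV[A]_n) : nat := \sum_i (x ord0 i != y ord0 i).

Lemma hd_eq0 n (x y : 'rV[A]_n) : hdist x y = 0%N -> x = y.
Proof.
move=> h0; apply: row_eqP => i; apply/eqP.
by have /eqP := h0; rewrite sum_nat_eq0 => /forallP/(_ i)/=; rewrite eqb0 negbK.
Qed.

Lemma hd_upd n (x y : 'rV[A]_n) k : x ord0 k != y ord0 k ->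
  hdist x y = (hdist (upd k (y ord0 k) x) y).+1.
Proof.
move=> xyk; rewrite /hdist (bigD1 k) //= xyk [in RHS](bigD1 k) //= upd_in eqxx add0n add1n.
by congr S; apply: eq_bigr => i ik; rewrite upd_out.
Qed.

Lemma hd_gt0 n (x y : 'rV[A]_n) : x != y -> exists k, x ord0 k != y ord0 k.
Proof.
move=> xy; apply: contrapT => no; case/eqP: xy; apply: row_eqP => i.
by apply/eqP/negP => /negP xyi; apply: no; exists i.
Qed.

(** Walk from the first point to the second, correcting one coordinate at a time:
    the function changes at one of the steps. *)
Lemma vary_on_line n (B : eqType) (phi : 'rV[A]_n -> B) x y :
  phi x != phi y -> exists k z,
  x ord0 k != y ord0 k /\ phi z != phi (upd k (y ord0 k) z).
Proof.
have [m] := ubnP (hdist x y); elim: m x => // m IHm x hxy pxy.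
have /hd_gt0[k xyk] : x != y by apply: contraNneq pxy => ->.
have [e|ne] := eqVneq (phi x) (phi (upd k (y ord0 k) x)); last by exists k, x.
have [||l [z [xyl pz]]] := IHm (upd k (y ord0 k) x).
- by move: hxy; rewrite (hd_upd xyk); lia.
- by rewrite -e.
exists l, z; split=> //; apply: contraNneq xyl => xyl.
by have [->|lk] := eqVneq l k; rewrite ?upd_in ?upd_out // xyl.
Qed.

Definition values n (y : 'I_n) (phi : 'rV[A]_n -> A) x : {set A} :=
  [set phi (upd y b x) | b : A]%SET.

Lemma valuesP n (y : 'I_n) phi x b : phi (upd y b x) \in values y phi x.
Proof. exact: imset_f. Qed.

Lemma fresh (s : seq A) : size s < #|A| -> exists e, e \notin s.
Proof.
move=> sA; apply/existsP; apply: contraLR sA; rewrite negb_exists -leqNgt => /forallP As.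
apply: leq_trans (card_size s); apply: subset_leq_card; apply/subsetP => a _.
by have := As a; rewrite negbK.
Qed.

Hypothesis A5 : 5 <= #|A|.

Lemma pick3 (S : {set A}) w : 3 <= #|S| -> w \in S ->
  exists u v, [/\ u \in S, v \in S, u != w, v != w & u != v].
Proof.
move=> S3 wS; have /card_gt0P[u] : 0 < #|S :\ w| by have := cardsD1 w S; rewrite wS; lia.
rewrite in_setD1 => /andP[uw uS].
have /card_gt0P[v] : 0 < #|S :\ w :\ u|.
  by have := cardsD1 w S; have := cardsD1 u (S :\ w); rewrite wS in_setD1 uw uS; lia.
rewrite !in_setD1 => /and3P[vu vw vS].
by exists u, v; split; rewrite // eq_sym.
Qed.

(** Call a pair of letters {u, v} blind to a line if [phi] avoids both on it.  If a
    blind pair never met another line without containing all its values, then a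
    line with three missing letters would force every line that meets the missing
    letters to be constant, by intersecting two pairs.  A line through a point
    where [phi] is a missing letter has at most two values, so the five letters
    leave it three missing ones; applying this remark to it and then to the line
    [x0], every line would be constant. *)
Lemma mixed_line n (y : 'I_n) (phi : 'rV[A]_n -> A) :
  (forall v, exists x, phi x = v) ->
  (exists z b, phi z != phi (upd y b z)) ->
  (exists x0, #|values y phi x0| + 2 <= #|A|) ->
  exists u v x0 x1 c d, [/\ u != v, u \notin values y phi x0, v \notin values y phi x0,
    phi (upd y c x1) \notin [set u; v]%SET & phi (upd y d x1) \in [set u; v]%SET].
Proof.
move=> surj [z [b zb]] [x0 x0V]; apply: contrapT => no.
have NM u v x x1 c d : u != v -> u \notin values y phi x -> v \notin values y phi x ->
    phi (upd y d x1) \in [set u; v]%SET -> phi (upd y c x1) \in [set u; v]%SET.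
  move=> uv ux vx dx; apply/negP => /negP cx; apply: no.
  by exists u, v, x, x1, c, d.
have cst x : #|values y phi x| + 3 <= #|A| -> forall x1 c d,
    phi (upd y d x1) \notin values y phi x -> phi (upd y c x1) = phi (upd y d x1).
  move=> x3 x1 c d; set w := phi (upd y d x1) => wx.
  have wC : w \in ~: values y phi x by rewrite in_setC.
  have C3 : 3 <= #|~: values y phi x| by have := cardsC (values y phi x); lia.
  have [u [v [uC vC uw vw uv]]] := pick3 C3 wC.
  rewrite !in_setC in uC vC.
  have := NM w u x x1 c d; rewrite eq_sym uw wx uC !in_set2 eqxx => /(_ isT isT isT isT).
  have := NM w v x x1 c d; rewrite eq_sym vw wx vC !in_set2 eqxx => /(_ isT isT isT isT).
  move=> /orP[/eqP //|/eqP ->] /orP[/eqP //|/eqP e].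
  by rewrite e eqxx in uv.
have [u uC] : exists u, u \in ~: values y phi x0.
  by apply/set0Pn; rewrite -card_gt0; have := cardsC (values y phi x0); lia.
have [v] : exists v, v \in ~: values y phi x0 :\ u.
  apply/set0Pn; rewrite -card_gt0; have := cardsC (values y phi x0).
  by have := cardsD1 u (~: values y phi x0); rewrite uC; lia.
rewrite in_setD1 !in_setC in uC * => /andP[vu vC].
have [x1 x1u] := surj u.
have x1sub : values y phi x1 \subset [set u; v]%SET.
  apply/subsetP => _ /imsetP[c _ ->].
  apply: (@NM u v x0 x1 c (x1 ord0 y)) => //; first by rewrite eq_sym.
  by rewrite upd_id x1u in_set2 eqxx.
(* Now the line of [x1] plays the part of the line with three missing letters. *)
have x13 : #|values y phi x1| + 3 <= #|A|.
  by have := subset_leq_card x1sub; rewrite cards2; lia.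
have x0c c d : phi (upd y c x0) = phi (upd y d x0).
  apply: (cst x1 x13); apply: contraL (valuesP y phi x0 d) => /(subsetP x1sub).
  by rewrite in_set2 => /orP[] /eqP ->.
have x03 : #|values y phi x0| + 3 <= #|A|.
  suff : values y phi x0 \subset [set phi x0]%SET by move/subset_leq_card; rewrite cards1; lia.
  apply/subsetP => _ /imsetP[c _ ->].
  by rewrite in_set1 -{2}(upd_id y x0) (x0c _ (x0 ord0 y)).
have x0v w : w \in values y phi x0 -> w = phi x0.
  by move=> /imsetP[c _ ->]; rewrite -{2}(upd_id y x0); apply: x0c.
case/eqP: zb; have [/x0v zx0|/cst] := boolP (phi (upd y b z) \in values y phi x0); last first.
  by move=> /(_ x03 (z ord0 y)); rewrite upd_id.
have [/x0v -> //|] := boolP (phi z \in values y phi x0).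
by rewrite -{1}(upd_id y z) => /(cst _ x03) ->; rewrite upd_id.
Qed.

End Hamming.

(** * A gate that fixes a line and moves its direction *)

Section Seed.
Variables (A : finType) (G : gate_clone A).
Hypothesis A5 : 5 <= #|A|.

Definition inert n (g : {perm 'rV[A]_n}) y x := [forall b, g (upd y b x) == upd y b x].

Lemma inertP n (g : {perm 'rV[A]_n}) y x :
  reflect (forall b, g (upd y b x) = upd y b x) (inert g y x).
Proof. exact: 'forall_eqP. Qed.

Lemma conj_tperm_fix n (g : {perm 'rV[A]_n}) i u v x : u != v ->
  ((g * at_wire i (tperm u v) * g^-1) x == x) = (g x ord0 i \notin [set u; v]).
Proof.
move=> uv; rewrite !permM (can2_eq (permKV g) (permK g)) in_set2 negb_or.
apply/eqP/andP => [/(congr1 (fun z : 'rV[A]_n => z ord0 i))|[gu gv]].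
  rewrite at_wire_in => e; split; apply/eqP => w; move: e.
    by rewrite w tpermL => /esym/eqP; rewrite (negPf uv).
  by rewrite w tpermR => /eqP; rewrite (negPf uv).
by rewrite at_wireE tpermD 1?eq_sym // upd_id.
Qed.

Definition moves_wire n (g : {perm 'rV[A]_n}) y := exists q, g q ord0 y != q ord0 y.

(** The raw material of the construction.  That the same wire is moved elsewhere
    excludes gates which merely ignore it. *)
Definition seed := exists n (y : 'I_n) (h : {perm 'rV[A]_n}),
  [/\ h \in G n, exists x0, inert h y x0 & moves_wire h y].

(** If [h] keeps the wire [y] everywhere, then [y] acts as a control, as the point
    that is moved on the line [x1] shows: the word [k] below, which combines [h]
    with a transposition of [c] and [d] on [y], is the identity when [y] carries
    any other letter, but it moves a wire [l] that [h] moves.  So [y] can be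
    traded for [l]. *)
Lemma seed_of_mixed n (y : 'I_n) (h : {perm 'rV[A]_n}) x0 x1 c d :
  h \in G n -> inert h y x0 -> h (upd y c x1) = upd y c x1 ->
  h (upd y d x1) != upd y d x1 -> seed.
Proof.
move=> Gh h0 hc hd'.
have [my|nomove] := pselect (moves_wire h y).
  by exists n, y, h; split=> //; exists x0.
have hy q : h q ord0 y = q ord0 y by apply/eqP/negP => /negP q'; apply: nomove; exists q.
have hVy q : h^-1 q ord0 y = q ord0 y by rewrite -[in LHS](hy (h^-1 q)) permKV.
set p := upd y d x1; have [l pl] := hd_gt0 hd'.
have ly : l != y by apply: contraNneq pl => ->; rewrite hy.
have cd : c != d by apply: contraNneq hd' => <-; rewrite hc.
pose v := at_wire y (tperm c d).
have vV : v^-1 = v by rewrite at_wireV tpermV.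
pose k := v * h^-1 * v * h.
have [e ecd] : exists e, e \notin [set c; d]%SET.
  have := cardsC [set c; d]%SET; rewrite cards2 => cC.
  have /card_gt0P[e] : 0 < #|~: [set c; d]%SET| by move: cC; lia.
  by rewrite in_setC; exists e.
exists n, l, k; split.
- by rewrite !groupM ?groupV ?clone_at_wire.
- exists (upd y e x1); apply/inertP => b.
  set q := upd l b _; have qy : q ord0 y = e by rewrite upd_out 1?eq_sym // upd_in.
  have vid (z : 'rV[A]_n) : z ord0 y = e -> v z = z.
    move=> ze; rewrite at_wireE ze tpermD -?ze ?upd_id //.
      by apply: contraNneq ecd => ->; rewrite ze in_set2 eqxx.
    by apply: contraNneq ecd => ->; rewrite ze in_set2 eqxx orbT.
  by rewrite !permM (vid q) // (vid (h^-1 q)) ?hVy // permKV.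
- exists p; rewrite !permM at_wire_upd tpermR -{1}hc permK at_wire_upd tpermL.
  exact: pl.
Qed.

(** Conjugating by [g] a transposition of the letters given by [mixed_line] on the
    wire [i], the moved points are those where [phi] is one of these letters. *)
Lemma seed_of_line n (g : {perm 'rV[A]_n}) i y (phi := fun x => g x ord0 i) :
  g \in G n -> (exists z b, phi z != phi (upd y b z)) ->
  (exists x0, #|values y phi x0| + 2 <= #|A|) -> seed.
Proof.
move=> Gg vary few.
have surj v : exists x, phi x = v.
  by exists (g^-1 (rowf (fun _ => v))); rewrite /phi permKV rowfE.
have [u [v [x0 [x1 [c [d [uv u0 v0 c1 d1]]]]]]] := mixed_line A5 surj vary few.
apply: (@seed_of_mixed _ y (g * at_wire i (tperm u v) * g^-1) x0 x1 c d).
- by rewrite !groupM ?groupV ?clone_at_wire.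
- apply/inertP => b; apply/eqP; rewrite conj_tperm_fix // in_set2 negb_or.
  by apply/andP; split; [apply: contraNneq u0 | apply: contraNneq v0] => <-; apply: valuesP.
- by apply/eqP; rewrite conj_tperm_fix.
- by rewrite conj_tperm_fix // negbK.
Qed.

(** Double counting of the pairs consisting of a point and a letter, where the
    involution exchanges the letter with the one at wire [k]. *)
Lemma line_count n (k : 'I_n) (S : {set 'rV[A]_n}) :
  \sum_x #|[set b | upd k b x \in S]| = (#|A| * #|S|)%N.
Proof.
pose h (p : 'rV[A]_n * A) := (upd k p.2 p.1, p.1 ord0 k).
have hK : involutive h by move=> [x b]; rewrite /h /= upd_in upd_upd upd_id.
transitivity (\sum_p nat_of_bool ((h p).1 \in S)).
  rewrite -(pair_bigA _ (fun x b => nat_of_bool ((h (x, b)).1 \in S))) /=.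
  by apply: eq_bigr => x _; rewrite -sum1dep_card big_mkcond.
rewrite -(reindex_inj (P := xpredT) (F := fun p => nat_of_bool (p.1 \in S)) (inv_inj hK)) /=.
rewrite -(pair_bigA _ (fun x b => nat_of_bool (x \in S))) /=.
rewrite mulnC -[RHS]sum_nat_const [RHS]big_mkcond.
by apply: eq_bigr => x _; rewrite sum_nat_const; case: (x \in S); rewrite ?muln0 ?muln1.
Qed.

Lemma surj_inj (f : A -> A) : (forall c, exists v, f v = c) -> injective f.
Proof.
move=> /choice[s fs]; have [t st ts] := injF_bij (can_inj fs).
have ft : f =1 t by move=> v; rewrite -{1}(ts v) fs.
by move=> u v; rewrite !ft; apply: (can_inj ts).
Qed.

(** Let the output [i] of [f] depend on the input [j] and on others.  There are then
    [x] and [x'] with the same output [i] and different inputs [j].  Either this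
    output takes at most two values on the [j]-line of [x'], and [f] itself can be
    used; or a transposition on the wire [j] that fixes [x] changes the output at
    [x'], so that after conjugation by [f] it becomes a gate [F] whose output [i]
    is not a function of the input [i].  As [F] moves a proportion 2/|A| of all
    points, some line in the relevant direction has at most two moved points,
    hence at most three values of the output [i]. *)
Lemma seed_of_nondegenerate n (f : {perm 'rV[A]_n}) :
  f \in G n -> ~ degenerate f -> seed.
Proof.
move=> Gf nd.
have [i nd_i] : exists i, forall j, exists x y : 'rV[A]_n,
    x ord0 j = y ord0 j /\ f x ord0 i <> f y ord0 i.
  apply: contrapT => no; apply: nd => i; apply: contrapT => noj; apply: no; exists i => j.
  apply: contrapT => noxy; apply: noj; exists j => x y exy; apply: contrapT => ne.
  by apply: noxy; exists x, y.
pose phi x := f x ord0 i.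
have [j [p [b pb]]] : exists j p b, phi p != phi (upd j b p).
  have [x [y [_ /eqP xy]]] := nd_i i.
  by have [j [p [_ pj]]] := vary_on_line (phi := phi) xy; exists j, p, (y ord0 j).
have [x [x' [xx' xj]]] : exists x x', phi x = phi x' /\ x ord0 j != x' ord0 j.
  apply: contrapT => no.
  (* Otherwise the input [j] is a function of the output [i]; being onto the finite
     set [A], this function is injective, and the output depends on [j] only. *)
  have phij x x' : phi x = phi x' -> x ord0 j = x' ord0 j.
    by move=> e; apply/eqP/negP => /negP xj; apply: no; exists x, x'.
  pose r v := f^-1 (rowf (fun _ => v)).
  have rP v : phi (r v) = v by rewrite /phi permKV rowfE.
  have rj z : r (phi z) ord0 j = z ord0 j by apply: phij; rewrite rP.
  have r_inj : injective (fun v => r v ord0 j).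
    apply: surj_inj => c; exists (phi (rowf (fun _ => c))).
    by rewrite rj rowfE.
  have [x [y [xy ne]]] := nd_i j; apply: ne; apply: r_inj => /=.
  by rewrite -/(phi x) -/(phi y) !rj.
have [all_c|/existsNP[b' /not_implyP[b'x /eqP b'c]]] :=
  pselect (forall b, b <> x ord0 j -> phi (upd j b x') = phi x).
  apply: (seed_of_line Gf (i := i) (y := j)); first by exists p, b.
  exists x'.
  suff /subset_leq_card V2 : values j phi x' \subset [set phi x; phi (upd j (x ord0 j) x')].
    by apply: leq_trans (leq_add V2 (leqnn 2)) _; rewrite cards2; lia.
  apply/subsetP => _ /imsetP[c _ ->]; rewrite in_set2.
  by have [->|/eqP/all_c ->] := eqVneq c (x ord0 j); rewrite eqxx ?orbT.
pose t := tperm (x' ord0 j) b'.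
pose F := f^-1 * at_wire j t * f.
have GF : F \in G n by rewrite !groupM ?groupV ?clone_at_wire.
pose phiF z := F z ord0 i.
have Fx : phiF (f x) = phi x.
  by rewrite /phiF !permM permK at_wireE tpermD ?upd_id // 1?eq_sym //; apply/eqP => e; case: b'x.
have Fx' : phiF (f x') != phi x.
  by rewrite /phiF !permM permK at_wireE tpermL.
have /vary_on_line[k [w [fk wk]]] : phiF (f x) != phiF (f x') by rewrite Fx eq_sym.
have ki : k != i by apply: contraNneq fk => ->; rewrite -/(phi _) xx'.
apply: (seed_of_line GF (i := i) (y := k)); first by exists w, (f x' ord0 k).
pose M := [set z | F z != z].
(* If all [k]-lines had three moved points, [F] would move a proportion 3/|A| of
   the points, but it moves only 2/|A| of them. *)
have [x0 x0M] : exists x0, #|[set b | upd k b x0 \in M]| <= 2.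
  apply: contrapT => no.
  have le3 z : 3 <= #|[set b | upd k b z \in M]|.
    by rewrite ltnNge; apply/negP => z2; apply: no; exists z.
  pose S := [set z : 'rV[A]_n | z ord0 j \in [set x' ord0 j; b']].
  have MS : #|M| <= #|S|.
    rewrite -[#|S|](card_imset _ (@perm_inj _ f)); apply: subset_leq_card.
    apply/subsetP => z; rewrite -[z](permKV f) (mem_imset _ _ perm_inj) in_set.
    apply: contraR; rewrite in_set in_set2 negb_or => /andP[z1 z2].
    by rewrite !permM permK at_wireE tpermD ?upd_id // eq_sym.
  have S2 z : #|[set b | upd j b z \in S]| = 2.
    have -> : [set b | upd j b z \in S] = [set x' ord0 j; b'].
      by apply/setP => b0; rewrite !in_set upd_in.
    rewrite cards2; suff -> : x' ord0 j != b' by [].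
    by apply: contraNneq b'c => <-; rewrite upd_id xx'.
  have := line_count k M; have := line_count j S.
  have sumc c : \sum_(z : 'rV[A]_n) c = (#|{: 'rV[A]_n}| * c)%N.
    by rewrite sum_nat_const.
  under eq_bigr => z _ do rewrite S2.
  rewrite sumc => cS cM.
  have : \sum_(x : 'rV[A]_n) 3 <= #|A| * #|M| by rewrite -cM; apply: leq_sum.
  rewrite sumc.
  have : 0 < #|{: 'rV[A]_n}| by apply/card_gt0P; exists x.
  have := leq_mul (leqnn #|A|) MS; rewrite -cS.
  by move: (#|A| * #|M|)%N #|{: 'rV[A]_n}| => u v; clear; lia.
exists x0.
suff : values k phiF x0 \subset
    x0 ord0 i |: [set phiF (upd k b x0) | b in [set b | upd k b x0 \in M]].
  move=> /subset_leq_card V3; apply: leq_trans (leq_add V3 (leqnn 2)) _.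
  apply: (@leq_trans (3 + 2)) => //; rewrite leq_add2r cardsU1.
  apply: (@leq_add _ _ 1 2) (leq_b1 _) _.
  exact: leq_trans (leq_imset_card _ _) x0M.
apply/subsetP => _ /imsetP[c _ ->]; rewrite in_setU1.
have [cM|] := boolP (upd k c x0 \in M).
  by apply/orP; right; apply: imset_f; rewrite in_set.
by rewrite in_set negbK => /eqP e; rewrite /phiF e upd_out ?eqxx // eq_sym.
Qed.

End Seed.

(** * Nondegenerate gates distort the Hamming metric *)

Section Isometry.
Variables (A : finType).
Hypothesis A5 : 5 <= #|A|.

Lemma hdxx n (x : 'rV[A]_n) : hdist x x = 0%N.
Proof. by apply: big1 => i _; rewrite eqxx. Qed.

Lemma hd_triangle n (x y z : 'rV[A]_n) : hdist x z <= hdist x y + hdist y z.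
Proof.
rewrite /hdist -big_split /=; apply: leq_sum => i _.
by case: (eqVneq (x ord0 i) (y ord0 i)) => [->|_]; rewrite ?add0n // add1n; case: (_ != _).
Qed.

Lemma hd_le n (x y : 'rV[A]_n) : hdist x y <= n.
Proof.
rewrite -[X in _ <= X]card_ord -sum1_card; apply: leq_sum => i _.
by case: (_ != _).
Qed.

Lemma hd_row_mx n m (x y : 'rV[A]_n) (z w : 'rV[A]_m) :
  hdist (row_mx x z) (row_mx y w) = (hdist x y + hdist z w)%N.
Proof.
rewrite /hdist big_split_ord /=; congr addn; apply: eq_bigr => i _.
  by rewrite !row_mxEl.
by rewrite !row_mxEr.
Qed.

Lemma hd_eq_max n (x y : 'rV[A]_n) : hdist x y = n -> forall i, x ord0 i != y ord0 i.
Proof.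
move=> h i; apply/negP => /eqP e.
suff : hdist x y < n by rewrite h ltnn.
rewrite /hdist (bigD1 i) //= e eqxx add0n.
apply: (@leq_ltn_trans (\sum_(j < n | j != i) 1)).
  by apply: leq_sum => j _; case: (_ != _).
rewrite sum1_card (eq_card (_ : _ =i predC1 i)) // cardC1 card_ord.
by rewrite ltn_predL (leq_ltn_trans _ (ltn_ord i)).
Qed.

Lemma hd_change n (z p q : 'rV[A]_n) k : (forall l, l != k -> p ord0 l = q ord0 l) ->
  (hdist z p + (z ord0 k != q ord0 k) = hdist z q + (z ord0 k != p ord0 k))%N.
Proof.
move=> pq; rewrite /hdist (bigD1 k) //= [in RHS](bigD1 k) //=.
rewrite (eq_bigr (fun i => (z ord0 i != q ord0 i) : nat)) => [|i ik]; last by rewrite pq.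
lia.
Qed.

Lemma hd1_eq n (p q : 'rV[A]_n) k : hdist p q = 1%N -> p ord0 k != q ord0 k ->
  forall l, l != k -> p ord0 l = q ord0 l.
Proof.
move=> pq1 pqk l lk; have [h] : 1%N = (hdist (upd k (q ord0 k) p) q).+1 by rewrite -hd_upd.
by rewrite -(hd_eq0 (esym h)) upd_out.
Qed.

Definition isometry n (f : {perm 'rV[A]_n}) := forall x y, hdist (f x) (f y) = hdist x y.

(** Take a line in the direction [j] along which the output [i] varies.  Whether
    z_j = p_j can be read off the difference of the distances from z to p and to
    another point of that line, and in the same way whether (f z)_i = (f p)_i.
    As [f] preserves distances, the output [i] is a function of the input [j]. *)
Lemma isometry_degenerate n (f : {perm 'rV[A]_n}) : isometry f -> degenerate f.
Proof.
move=> isof i.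
have A2 : 1 < #|A| by lia.
have /card_gt0P[a _] : 0 < #|A| by lia.
have [b ba] := other A2 a.
have : f (f^-1 (rowf (fun _ => a))) ord0 i != f (f^-1 (rowf (fun _ => b))) ord0 i.
  by rewrite !permKV !rowfE eq_sym.
move=> /(vary_on_line (phi := fun x => f x ord0 i)) [j [p [_]]].
set b' := _ ord0 j => pb.
have sees (p' q' z : 'rV[A]_n) : hdist p' q' = 1%N -> p' ord0 j != q' ord0 j ->
    f p' ord0 i != f q' ord0 i ->
    (z ord0 j == p' ord0 j) = (f z ord0 i == f p' ord0 i).
  move=> pq1 pqj fpq.
  have fpq1 : hdist (f p') (f q') = 1%N by rewrite isof.
  have := hd_change z (hd1_eq pq1 pqj).
  have := hd_change (f z) (hd1_eq fpq1 fpq).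
  rewrite !isof; case: (eqVneq (z ord0 j) (p' ord0 j)) => [->|zp].
    rewrite pqj; case: (eqVneq (f z ord0 i) (f p' ord0 i)) => // fzp.
    by case: (f z ord0 i != _); lia.
  case: (eqVneq (f z ord0 i) (f p' ord0 i)) => // ->.
  by rewrite fpq; case: (z ord0 j != _); lia.
have line1 c d : c != d -> hdist (upd j c p) (upd j d p) = 1%N.
  move=> cd; rewrite (hd_upd (k := j)) ?upd_in // upd_upd hdxx //.
have pj c : c != p ord0 j -> f p ord0 i != f (upd j c p) ord0 i.
  move=> cp; have b'p : p ord0 j != b'.
    by apply: contraNneq pb => <-; rewrite upd_id.
  have pb1 : hdist p (upd j b' p) = 1%N by rewrite -{1}(upd_id j p) line1.
  have := sees p (upd j b' p) (upd j c p) pb1; rewrite !upd_in (negPf cp).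
  by move=> /(_ b'p pb); rewrite eq_sym => <-.
exists j => x y xy.
have pick (z : 'rV[A]_n) : f z ord0 i = f (upd j (z ord0 j) p) ord0 i.
  apply/eqP; have [e|ne] := eqVneq (z ord0 j) (p ord0 j).
    have [c cp] := other A2 (p ord0 j).
    rewrite e upd_id -(sees p (upd j c p)) ?e //.
    - by rewrite -{1}(upd_id j p) line1 // eq_sym.
    - by rewrite upd_in eq_sym.
    - exact: pj.
  rewrite -(sees (upd j (z ord0 j) p) p) ?upd_in //.
    by rewrite -{2}(upd_id j p) line1.
  by rewrite eq_sym pj.
by rewrite pick xy -pick.
Qed.

(** The inverse of a permutation of a finite type is one of its powers. *)
Lemma perm_closed_inv (T : finType) (R : T -> T -> Prop) (f : {perm T}) :
  (forall x y, R x y -> R (f x) (f y)) -> forall x y, R (f x) (f y) -> R x y.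
Proof.
move=> Rf x y Rxy; have fk k u v : R u v -> R ((f ^+ k) u) ((f ^+ k) v).
  by elim: k u v => [|k IHk] u v uv; rewrite ?expg0 ?perm1 // expgS !permM; apply/IHk/Rf.
by have := fk #[f].-1 _ _ Rxy; rewrite -invg_expg !permK.
Qed.

(** Distances are lengths of shortest paths of adjacent points, so [f] does not
    increase them; nor does its inverse. *)
Lemma adjacency_isometry n (f : {perm 'rV[A]_n}) :
  (forall x y, hdist x y = 1%N -> hdist (f x) (f y) = 1%N) -> isometry f.
Proof.
move=> f1; have fle d x y : hdist x y <= d -> hdist (f x) (f y) <= d.
  elim: d x y => [|d IHd] x y.
    by rewrite leqn0 => /eqP/hd_eq0 ->; rewrite hdxx.
  have [->|/hd_gt0[k xyk]] := eqVneq x y; first by rewrite !hdxx.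
  rewrite (hd_upd xyk) ltnS => /IHd h.
  apply: leq_trans (hd_triangle _ (f (upd k (y ord0 k) x)) _) _.
  apply: (@leq_add _ _ 1 d) h; rewrite f1 //.
  by rewrite (@hd_upd _ _ _ _ k); rewrite upd_in ?hdxx.
move=> x y; apply/eqP; rewrite eqn_leq fle //=.
by apply: (perm_closed_inv (R := fun u v => hdist u v <= hdist (f x) (f y)) (fle _)).
Qed.

Lemma rowf_inj n : injective (fun u : {ffun 'I_n -> A} => rowf u).
Proof.
by move=> u v uv; apply/ffunP => i; rewrite -[u i]rowfE -[v i]rowfE uv.
Qed.

Lemma card_common_opposite n (x y : 'rV[A]_n) :
  #|[set z | (hdist x z == n) && (hdist y z == n)]| =
    ((#|A| - 2) ^ hdist x y * (#|A| - 1) ^ (n - hdist x y))%N.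
Proof.
pose F i : pred A := predC (pred2 (x ord0 i) (y ord0 i)).
have opp (w z : 'rV[A]_n) : (hdist w z == n) = [forall i, w ord0 i != z ord0 i].
  apply/eqP/forallP => [/hd_eq_max //|wz].
  rewrite -[RHS]card_ord -sum1_card; apply: eq_bigr => i _; by rewrite wz.
have -> : [set z | (hdist x z == n) && (hdist y z == n)] =
    [set rowf u | u : {ffun 'I_n -> A} in family F].
  apply/setP => z; rewrite inE !opp.
  apply/andP/imsetP => [[/forallP xz /forallP yz]|[u /familyP uF ->]].
    exists [ffun i => z ord0 i]; last by apply: row_eqP => i; rewrite rowfE ffunE.
    by apply/familyP => i; rewrite ffunE !inE negb_or ![z _ _ == _]eq_sym xz yz.
  have ok i : (u i != x ord0 i) && (u i != y ord0 i) by have := uF i; rewrite !inE negb_or.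
  by split; apply/forallP => i; rewrite rowfE eq_sym; case/andP: (ok i).
rewrite card_imset; last exact: rowf_inj.
rewrite card_family foldrE big_map big_enum /=.
have cF i : #|F i| = ((#|A| - 2) ^ (x ord0 i != y ord0 i) * (#|A| - 1) ^ (x ord0 i == y ord0 i))%N.
  have : ((x ord0 i != y ord0 i).+1 + #|F i| = #|A|)%N by rewrite -card2 cardC.
  move: #|F i| => t; case: eqP => _ /=; rewrite ?expn0 ?expn1 ?mul1n ?muln1; lia.
rewrite (eq_bigr _ (fun i _ => cF i)) big_split /= -!expn_sum; congr (_ * _ ^ _)%N.
apply/eqP; rewrite -(eqn_add2r (hdist x y)) subnK ?hd_le // -big_split /=.
rewrite -[X in _ == X]card_ord -sum1_card; apply/eqP/eq_bigr => i _.
by case: eqP.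
Qed.

(** The number of points that differ from both [x] and [y] at all wires is preserved,
    and by [card_common_opposite] it determines the distance of [x] and [y]. *)
Lemma opposite_isometry n (f : {perm 'rV[A]_n}) :
  (forall x y, hdist x y = n -> hdist (f x) (f y) = n) -> isometry f.
Proof.
move=> fn; have fnV x y : (hdist (f x) (f y) == n) = (hdist x y == n).
  by apply/eqP/eqP => [|/fn //]; apply: (perm_closed_inv (R := fun u v => hdist u v = n)).
move=> x y; have : #|[set z | (hdist (f x) z == n) && (hdist (f y) z == n)]| =
    #|[set z | (hdist x z == n) && (hdist y z == n)]|.
  rewrite -[RHS](card_imset _ (@perm_inj _ f)); apply: eq_card => z.
  by rewrite -[z](permKV f) (mem_imset _ _ perm_inj) !inE !fnV.
rewrite !card_common_opposite.
have u0 : 0 < #|A| - 2 by lia.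
have uv : #|A| - 2 < #|A| - 1 by lia.
move: (#|A| - 2)%N (#|A| - 1)%N u0 uv (hd_le (f x) (f y)) (hd_le x y) => u v u0 uv.
suff lt d e : d < e -> e <= n -> u ^ e * v ^ (n - e) < u ^ d * v ^ (n - d).
  move=> dn en; case: (ltngtP (hdist (f x) (f y)) (hdist x y)) => // [/lt/(_ en)|/lt/(_ dn)]; lia.
move=> de en; have -> : e = (d + (e - d))%N by lia.
have -> : (n - d = (n - (d + (e - d))) + (e - d))%N by lia.
rewrite !expnD; set w := (n - _)%N.
rewrite [X in X < _]mulnAC [X in _ < X]mulnA ltn_pmul2l ?ltn_exp2r //; first by lia.
by rewrite muln_gt0 !expn_gt0 u0; apply/orP; left; lia.
Qed.

Lemma nondegenerate_stretch n (f : {perm 'rV[A]_n}) : ~ degenerate f ->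
  exists x y, hdist x y = 1%N /\ 1 < hdist (f x) (f y).
Proof.
move=> nd; apply: contrapT => no; apply/nd/isometry_degenerate/adjacency_isometry => x y xy1.
apply/eqP; rewrite eqn_leq lt0n; apply/andP; split.
  by rewrite leqNgt; apply/negP => h; apply: no; exists x, y.
by apply/eqP => /hd_eq0/perm_inj xy; rewrite xy hdxx in xy1.
Qed.

Lemma nondegenerate_shrink n (f : {perm 'rV[A]_n}) : ~ degenerate f ->
  exists x y, hdist x y = n /\ hdist (f x) (f y) < n.
Proof.
move=> nd; apply: contrapT => no; apply/nd/isometry_degenerate/opposite_isometry => x y xyn.
apply/eqP; rewrite eqn_leq hd_le leqNgt.
by apply/negP => h; apply: no; exists x, y.
Qed.

End Isometry.

(** * Two-transitivity *)

Section Distances.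
Variables (A : finType) (G : gate_clone A).
Hypothesis A5 : 5 <= #|A|.

(** The orbits of [G n] on pairs of points are unions of the classes of pairs at a
    given Hamming distance; [fused n d d'] says that [d] and [d'] share an orbit. *)
Definition fused n d d' := forall x y x' y' : 'rV[A]_n, hdist x y = d -> hdist x' y' = d' ->
  exists2 g, g \in G n & g x = x' /\ g y = y'.

Lemma perm_sets (T : finType) (D D' : {set T}) : #|D| = #|D'| ->
  exists p : {perm T}, forall i, (p i \in D') = (i \in D).
Proof.
move=> DD'; pose en (S : {set T}) := enum S ++ enum (~: S).
have en_uniq S : uniq (en S).
  rewrite cat_uniq !enum_uniq /= andbT; apply/hasPn => i.
  by rewrite !mem_enum inE.
have [|p] := perm_map_uniq (en_uniq D) (en_uniq D').
  by rewrite !size_cat -!cardE; have := cardsC D; have := cardsC D'; lia.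
move/eqP; rewrite map_cat eqseq_cat ?size_map -?cardE // => /andP[/eqP e1 /eqP e2].
exists p => i; have [iD|iD] := boolP (i \in D).
  by rewrite -mem_enum -e1 map_f ?mem_enum.
by apply/negbTE; rewrite -in_setC -mem_enum -e2 map_f ?mem_enum ?in_setC.
Qed.

Lemma perm_pairs (a b a' b' : A) : (a == b) = (a' == b') ->
  exists u : {perm A}, u a = a' /\ u b = b'.
Proof.
move=> ab; have [e|ne] := eqVneq a b.
  exists (tperm a a'); rewrite -e tpermL; split=> //.
  by apply/eqP; rewrite -ab e.
have [|||u [ua ub]] := @perm_map_uniq _ [:: a; b] [:: a'; b'] => //.
- by rewrite /= inE ne.
- by rewrite /= inE -ab ne.
by exists u.
Qed.

Lemma fused_refl n d : fused n d d.
Proof.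
move=> x y x' y' xyd xyd'.
pose D (u v : 'rV[A]_n) := [set i | u ord0 i != v ord0 i].
have cD u v : #|D u v| = hdist u v.
  by rewrite -sum1_card big_mkcond /=; apply: eq_bigr => i _; rewrite inE; case: eqP.
have [|p pD] := @perm_sets _ (D x y) (D x' y'); first by rewrite !cD xyd.
have /choice[u uP] : forall i, exists u : {perm A},
    u (x ord0 (p^-1 i)) = x' ord0 i /\ u (y ord0 (p^-1 i)) = y' ord0 i.
  move=> i; apply: perm_pairs; apply/negb_inj.
  by have := pD (p^-1 i); rewrite permKV !inE => ->.
exists (wire A p * \prod_(i <- enum 'I_n) at_wire i (u i)).
  rewrite groupM ?clone_wire // big_seq group_prod // => i _; exact: clone_at_wire.
split; apply: row_eqP => i; rewrite permM prod_actE ?enum_uniq // mem_enum wireE.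
  by have [] := uP i.
by have [] := uP i.
Qed.

Lemma fused_of n (g : {perm 'rV[A]_n}) x y : g \in G n ->
  fused n (hdist x y) (hdist (g x) (g y)).
Proof.
move=> Gg x1 y1 x2 y2 e1 e2.
have [f Gf [fx fy]] := fused_refl e1 (erefl (hdist x y)).
have [h Gh [hx hy]] := fused_refl (erefl (hdist (g x) (g y))) e2.
by exists (f * g * h); rewrite ?groupM // !permM fx fy hx hy.
Qed.

Lemma fused_sym n d d' : fused n d d' -> fused n d' d.
Proof.
move=> dd' x y x' y' xy xy'; have [g Gg [gx gy]] := dd' _ _ _ _ xy' xy.
by exists g^-1; rewrite ?groupV // -gx -gy !permK.
Qed.

Lemma hd_exists n d : d <= n -> exists x y : 'rV[A]_n, hdist x y = d.
Proof.
move=> dn; have /card_gt0P[a _] : 0 < #|A| by lia.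
have [|b ba] := @other A _ a; first by lia.
exists (rowf (fun i : 'I_n => a)), (rowf (fun i : 'I_n => if i < d then b else a)).
rewrite -[RHS]card_ord -sum1_card (big_ord_widen n (fun=> 1%N) dn) [RHS]big_mkcond /=.
by apply: eq_bigr => i _; rewrite !rowfE; case: ifP => _; rewrite ?eqxx // eq_sym ba.
Qed.

Lemma fused_trans n d d' d'' : d' <= n -> fused n d d' -> fused n d' d'' -> fused n d d''.
Proof.
move=> /hd_exists[u [v uv]] dd' dd'' x y x' y' xy xy'.
have [g Gg [gx gy]] := dd' _ _ _ _ xy uv; have [h Gh [hx hy]] := dd'' _ _ _ _ uv xy'.
by exists (g * h); rewrite ?groupM // !permM gx gy.
Qed.

Lemma fused_ext k n t (g : {perm 'rV[A]_k}) x y : g \in G k -> k + t <= n ->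
  fused n (hdist x y + t) (hdist (g x) (g y) + t).
Proof.
move=> Gg ktn; have [z [w zw]] : exists z w : 'rV[A]_(n - k), hdist z w = t.
  by apply: hd_exists; lia.
have e : n = (k + (n - k))%N by lia.
have Ge : ext (@lshift_inj k (n - k)) g \in G (k + (n - k))%N by apply: clone_ext.
have := @fused_of _ _ (row_mx x z) (row_mx y w) Ge.
by rewrite !ext_lshift_row_mx !hd_row_mx zw -e.
Qed.

(** Let [h] fix the line [x0] and send [q] to [h q], with different letters at [y].
    Moving the letter of the point of the line among those of [q] and of [h q] and
    a third one shifts the two distances independently by one, so that the
    distances to [h q] of two points of the line become fused.  Idle wires shift
    both by any amount. *)
Lemma fused_of_seed : seed G ->
  exists k, forall n w, k <= w -> w + k <= n -> fused n w w.+1.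
Proof.
move=> [k [y [h [Gh [x0 /inertP h0] [q hq]]]]]; exists k => n w kw wn.
pose dist (p : 'rV[A]_k) := hdist (upd y (p ord0 y) x0) p.
have distE b (p : 'rV[A]_k) : hdist (upd y b x0) p = (dist p + (b != p ord0 y))%N.
  have [->|bp] := eqVneq b (p ord0 y); first by rewrite addn0.
  by rewrite (@hd_upd _ _ _ _ y) ?upd_in // upd_upd addn1.
have d2 : dist (h q) <= k by apply: hd_le.
have step b : fused n (hdist (upd y b x0) q + (w - dist (h q)))
                      (hdist (upd y b x0) (h q) + (w - dist (h q))).
  by rewrite -[in X in fused _ _ X](h0 b); apply: fused_ext => //; lia.
have [|b] := @fresh _ [:: q ord0 y; h q ord0 y]; first by apply: leq_trans A5.
rewrite !inE negb_or => /andP[b1 b2].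
have := step b; have := step (h q ord0 y); rewrite !distE b1 b2 hq eqxx.
have -> : (dist (h q) + false + (w - dist (h q)) = w)%N by lia.
have -> : (dist (h q) + true + (w - dist (h q)) = w.+1)%N by lia.
move=> /fused_sym sw; apply: fused_trans sw.
by have := hd_le (upd y b x0) q; rewrite distE b1; lia.
Qed.

(** All distances are fused with a middle one, [L]: those in the middle range by
    steps of one, the small ones by climbing with a pair that [f] stretches, and
    the large ones by descending with a pair that [f] contracts. *)
Theorem two_transitive n0 (f : {perm 'rV[A]_n0}) : f \in G n0 -> ~ degenerate f ->
  exists N, forall n, N <= n -> forall p q p' q' : 'rV[A]_n, p != q -> p' != q' ->
  exists2 w, w \in G n & w p = p' /\ w q = q'.
Proof.
move=> Gf nd; have [k mid] := fused_of_seed (seed_of_nondegenerate A5 Gf nd).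
have [x [y [xy1 fxy1]]] := nondegenerate_stretch A5 nd.
have [x' [y' [xyn fxyn]]] := nondegenerate_shrink A5 nd.
pose L := (k + n0).+1; exists (L + L)%N => n Ln.
have up w : w <= L -> 0 < w -> fused n w L.
  have [m] := ubnP (L - w); elim: m w => // m IHm w wm wL w0.
  have [->|wL'] := eqVneq w L; first exact: fused_refl.
  have [kw|wk] := leqP k w.
    have ww : fused n w w.+1 by apply: mid => //; rewrite /L in Ln wL *; lia.
    by apply: fused_trans ww _; [|apply: IHm]; rewrite /L in Ln wL wL' wm *; lia.
  have D := hd_le (f x) (f y).
  have ww : fused n w (w + (hdist (f x) (f y)).-1).
    have -> : w = (hdist x y + w.-1)%N by rewrite xy1; lia.
    have -> : (hdist x y + w.-1 + (hdist (f x) (f y)).-1 = hdist (f x) (f y) + w.-1)%N.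
      by rewrite xy1; lia.
    by apply: fused_ext => //; rewrite /L in Ln wL *; lia.
  by apply: fused_trans ww _; [|apply: IHm]; rewrite /L in Ln wL wL' wm *; lia.
have down w : L <= w -> w <= n -> fused n w L.
  have [m] := ubnP w; elim: m w => // m IHm w wm wL wn.
  have [->|wL'] := eqVneq w L; first exact: fused_refl.
  have [kw|wk] := leqP (w.-1 + k) n.
    have ww : fused n w w.-1.
      by apply: fused_sym; rewrite -{2}(@prednK w) ; [apply: mid|]; rewrite /L in Ln wL wL' *; lia.
    by apply: fused_trans ww _; [|apply: IHm]; rewrite /L in Ln wL wL' wm *; lia.
  have ww : fused n w (hdist (f x') (f y') + (w - n0)).
    have {1}-> : w = (hdist x' y' + (w - n0))%N by rewrite xyn; rewrite /L in wL; lia.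
    by apply: fused_ext => //; rewrite /L in Ln wL *; lia.
  by apply: fused_trans ww _; [|apply: IHm]; rewrite /L in Ln wL wL' wm *; lia.
have toL (p q : 'rV[A]_n) : p != q -> fused n (hdist p q) L.
  move=> pq; have [wL|wL] := leqP (hdist p q) L; last by apply: down (hd_le _ _); apply: ltnW.
  by apply: up => //; rewrite lt0n; apply: contraNneq pq => /hd_eq0 ->.
move=> p q p' q' pq pq'.
apply: (fused_trans _ (toL _ _ pq) (fused_sym (toL _ _ pq'))) => //.
by rewrite /L in Ln *; lia.
Qed.

End Distances.

(** * From one 3-cycle to all even permutations *)

Section TwoTransitive.
Variables (T : finType) (G : {group {perm T}}).

Section ThreeCycles.

Lemma tpermIf (x y z : T) :
  tperm x y z = if z == x then y else if z == y then x else z.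
Proof. by rewrite permE. Qed.

(** For distinct points the product is the 3-cycle a -> b -> c -> a; written with
    transpositions it still makes sense when b = c, where it is the identity. *)
Definition tri a b c := tperm a b * tperm a c \in G.

Lemma tri_sym a b c : tri a b c -> tri a c b.
Proof. by rewrite /tri => /groupVr; rewrite invMg !tpermV. Qed.

Lemma tri_trans a b c d : tri a b c -> tri a c d -> tri a b d.
Proof.
rewrite /tri => abc acd; have := groupM abc acd.
by rewrite mulgA -[X in X * _]mulgA tperm2 mulg1.
Qed.

(** Two 3-cycles with one common point [q]: their commutator is a 3-cycle on [q] and
    one further point of each.  The cases where the cycles share more points are
    products. *)
Lemma tri_share q p c r d :
  uniq [:: q; p; c] -> uniq [:: q; r; d] -> p != r ->
  tri q p c -> tri q r d -> tri q p r.
Proof.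
rewrite /= !inE !negb_or !andbT => /andP[/andP[qp qc] pc] /andP[/andP[qr qd] rd] pr.
move=> Gpc Grd; case: (eqVneq c r) => [<- //|cr].
case: (eqVneq d p) => [dp|dp]; first by apply: tri_sym; rewrite -dp.
case: (eqVneq c d) => [cd|cd].
  by apply: tri_trans Gpc _; rewrite cd; apply: tri_sym.
have := groupM (groupVr Gpc) (groupJ Gpc Grd).
set h := tperm q r * _; suff -> : (tperm q p * tperm q c)^-1 * (tperm q p * tperm q c) ^ h
   = tperm q r * tperm q p by move=> qrp; apply: tri_sym.
have hq : h q = r by rewrite permM tpermL tpermD // eq_sym.
have hp : h p = p by rewrite permM !tpermD // eq_sym.
have hc : h c = c by rewrite permM !tpermD // eq_sym.
rewrite invMg !tpermV conjMg !tpermJ hq hp hc.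
apply/permP => x; rewrite !permM !tpermIf.
have [qpF qcF qrF] : [/\ (q == p) = false, (q == c) = false & (q == r) = false].
  by split; exact: negbTE.
have [pcF prF crF] : [/\ (p == c) = false, (p == r) = false & (c == r) = false].
  by split; exact: negbTE.
have [pqF cqF rqF] : [/\ (p == q) = false, (c == q) = false & (r == q) = false].
  by split; rewrite eq_sym.
have [cpF rpF rcF] : [/\ (c == p) = false, (r == p) = false & (r == c) = false].
  by split; rewrite eq_sym.
pose E := (eqxx, qpF, qcF, qrF, pcF, prF, crF, (pqF, cqF, rqF, cpF, rpF, rcF)).
case: (x =P q) => [xq|/eqP/negbTE xqF] /=; first by do 6?rewrite ?xq ?E /=.
case: (x =P c) => [xc|/eqP/negbTE xcF] /=; first by do 6?rewrite ?xc ?E /=.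
case: (x =P p) => [xp|/eqP/negbTE xpF] /=; first by do 6?rewrite ?xp ?E /=.
case: (x =P r) => [xr|/eqP/negbTE xrF] /=; first by do 6?rewrite ?xr ?E /=.
by do 6?rewrite ?(xqF, xcF, xpF, xrF) /=.
Qed.

End ThreeCycles.

Hypothesis tr2 : forall p q p' q' : T, p != q -> p' != q' ->
  exists2 w, w \in G & w p = p' /\ w q = q'.

(** By 2-transitivity every pair of points lies in a 3-cycle of the group; two such
    3-cycles through [q] are combined by [tri_share]. *)
Lemma tri_all a b c :
  uniq [:: a; b; c] -> tri a b c ->
  forall p q r, q != p -> q != r -> tri q p r.
Proof.
move=> abc Gabc.
have step q p : q != p -> exists2 d, uniq [:: q; p; d] & tri q p d.
  move=> qp; have ab : a != b by case/andP: abc; rewrite inE negb_or => /andP[].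
  have [w Gw [wa wb]] := tr2 ab qp; exists (w c).
    by rewrite -wa -wb -[_ :: _]/(map w [:: a; b; c]) map_inj_uniq //; apply: perm_inj.
  by have := groupJ Gabc Gw; rewrite conjMg !tpermJ wa wb.
move=> p q r qp qr; case: (eqVneq p r) => [->|pr].
  by rewrite /tri tperm2 group1.
have [c' u Gc] := step _ _ qp; have [d v Gd] := step _ _ qr.
exact: tri_share u v pr Gc Gd.
Qed.

(** An even permutation is a product of pairs of transpositions, and a pair is a
    product of at most two of the permutations in [tri]. *)
Lemma tri_even a b c : uniq [:: a; b; c] -> tri a b c ->
  forall f : {perm T}, ~~ odd_perm f -> f \in G.
Proof.
move=> u Gabc; have triG := tri_all u Gabc.
have pairG p q r s : p != q -> r != s -> tperm p q * tperm r s \in G.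
  move=> pq rs; case: (eqVneq p r) => [e|pr]; first by rewrite -e; apply: triG; rewrite // e.
  have := groupM (triG q p r pq pr) (triG p r s _ rs); rewrite eq_sym => /(_ pr).
  by rewrite (tpermC r p) mulgA -[X in X * _]mulgA tperm2 mulg1.
move=> f; have [ts -> dts] := prod_tpermP f; rewrite odd_perm_prod //.
have [n] := ubnP (size ts); elim: n ts dts => // n IHn [|t1 [|t2 ts]] //=.
  by rewrite big_nil group1.
case/and3P => d1 d2 dts sz odd; rewrite !big_cons mulgA groupM ?pairG ?IHn //.
  by lia.
by rewrite negbK in odd.
Qed.

End TwoTransitive.

(** * Small supports yield 3-cycles *)

Section MinDegree.
Variables (T : finType) (G : {group {perm T}}).

Hypothesis tr2 : forall p q p' q' : T, p != q -> p' != q' ->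
  exists2 w, w \in G & w p = p' /\ w q = q'.

Definition supp (h : {perm T}) := [set x | h x != x].

Implicit Types (h k w : {perm T}).

Lemma supp_in h x : (h x \in supp h) = (x \in supp h).
Proof. by rewrite !inE (inj_eq perm_inj). Qed.

Lemma supp_out h x : x \notin supp h -> h x = x.
Proof. by rewrite inE negbK => /eqP. Qed.

Lemma suppV h : supp h^-1 = supp h.
Proof. by apply/setP => x; rewrite !inE (can2_eq (permKV h) (permK h)) eq_sym. Qed.

Lemma suppJ h w : supp (h ^ w) = [set x | w^-1 x \in supp h].
Proof.
apply/setP => x; rewrite !inE conjgE !permM.
by rewrite (can2_eq (permK w) (permKV w)).
Qed.

(** A point outside these three sets is treated by [h] and [k] as if they commuted. *)
Lemma supp_comm (h k : {perm T}) (B := supp h :&: supp k) :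
  supp [~ h, k] \subset B :|: h @: B :|: k @: B.
Proof.
apply/subsetP => x; apply: contraLR; rewrite !inE !negb_or negbK => /andP[/andP[xB xhB] xkB].
have {}xB : ~~ ((x \in supp h) && (x \in supp k)) by rewrite !inE.
have {}xhB : ~~ ((h^-1 x \in supp h) && (h^-1 x \in supp k)).
  by rewrite -in_setI; apply: contra xhB => /(imset_f h); rewrite permKV.
have {}xkB : ~~ ((k^-1 x \in supp h) && (k^-1 x \in supp k)).
  by rewrite -in_setI; apply: contra xkB => /(imset_f k); rewrite permKV.
have hV y : y \notin supp h -> h^-1 y = y by rewrite -suppV => /supp_out.
have kV y : y \notin supp k -> k^-1 y = y by rewrite -suppV => /supp_out.
have hin y : (h^-1 y \in supp h) = (y \in supp h) by rewrite -suppV supp_in.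
have kin y : (k^-1 y \in supp k) = (y \in supp k) by rewrite -suppV supp_in.
rewrite commgEl conjgE !permM.
case xh: (x \in supp h) xB => xB.
  rewrite hin xh /= in xhB; rewrite (kV _ xhB) permKV supp_out //.
rewrite hV ?xh //; case xk: (x \in supp k) xB => xB.
  by rewrite kin xk andbT in xkB; rewrite (supp_out xkB) permKV.
by rewrite kV ?xk // [h x]supp_out ?xh // [k x]supp_out ?xk.
Qed.

Lemma card_supp_comm (h k : {perm T}) :
  #|supp [~ h, k]| <= 3 * #|supp h :&: supp k|.
Proof.
apply: leq_trans (subset_leq_card (supp_comm h k)) _.
by rewrite !cardsU !(card_imset _ perm_inj); lia.
Qed.

Definition transporter p q P Q := [set w in G | (w p == P) && (w q == Q)].

(** By 2-transitivity, translating on both sides by elements of the group carries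
    one set into the other. *)
Lemma card_transporter_le p q p' q' P Q P' Q' :
  p != q -> p' != q' -> P != Q -> P' != Q' ->
  #|transporter p q P Q| <= #|transporter p' q' P' Q'|.
Proof.
move=> pq pq' PQ PQ'.
have [u Gu [up uq]] := tr2 pq' pq; have [v Gv [vP vQ]] := tr2 PQ PQ'.
rewrite -(card_imset _ (can_inj (mulgK v))) -(card_imset _ (can_inj (mulKg u))).
apply: subset_leq_card; apply/subsetP => _ /imsetP[_ /imsetP[w + ->] ->].
rewrite !inE => /andP[Gw /andP[/eqP wp /eqP wq]].
by rewrite !groupM // !permM up uq wp wq vP vQ !eqxx.
Qed.

Lemma card_transporter_sets (p q : T) (S1 S2 : {set T}) c :
  p != q -> (forall P Q, P != Q -> #|transporter p q P Q| = c) ->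
  #|[set w in G | (w p \in S1) && (w q \in S2)]| =
    (#|[set PQ in setX S1 S2 | PQ.1 != PQ.2]| * c)%N.
Proof.
move=> pq mc; rewrite -sum1_card (partition_big (fun w : {perm T} => (w p, w q))
  (mem [set PQ in setX S1 S2 | PQ.1 != PQ.2])) /=; last first.
  by move=> w; rewrite !inE => /andP[_ /andP[-> ->]]; rewrite (inj_eq perm_inj).
rewrite -sum_nat_const; apply: eq_bigr => -[P Q]; rewrite !inE /= => /andP[/andP[PS QS] PQ].
rewrite -(mc P Q PQ) -sum1_card; apply: eq_bigl => w; rewrite !inE xpair_eqE.
by case: eqP => [->|]; rewrite ?andbF //; case: eqP => [->|]; rewrite ?andbF // PS QS !andbT.
Qed.

Lemma card_offdiag (S : {set T}) :
  #|[set PQ in setX S S | PQ.1 != PQ.2]| = (#|S| * #|S|.-1)%N.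
Proof.
rewrite -sum1_card (eq_bigl (fun PQ => (PQ.1 \in S) && (PQ.2 \in S :\ PQ.1))); last first.
  by move=> PQ; rewrite !inE eq_sym andbC andbCA.
rewrite -(pair_big_dep (fun P => P \in S) (fun P Q => Q \in S :\ P) (fun _ _ => 1%N)) /=.
rewrite -sum_nat_const; apply: eq_bigr => P PS.
by rewrite sum1_card (cardsD1 P S) PS.
Qed.

Lemma card_setXC (S : {set T}) :
  #|[set PQ in setX S (~: S) | PQ.1 != PQ.2]| = (#|S| * (#|T| - #|S|))%N.
Proof.
rewrite -[#|T|](cardsC S) addKn -cardsX; apply: eq_card => PQ; rewrite !inE.
by case: eqP => [->|]; rewrite ?andbT // andbF andbN.
Qed.

(** Averages over the elements of the group that send [p] into [S] and [q] out of
    [S].  By 2-transitivity a pair of points is sent to each pair equally often,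
    which bounds the total overlap; the factor |S| common to both sides cancels. *)
Lemma mean_overlap (S : {set T}) p q b :
  p \in S -> q \in S -> p != q ->
  (forall w, w \in G -> w p \in S -> w q \notin S ->
     b <= #|[set x in S :\ p :\ q | w x \in S]|) ->
  b * (#|T| - #|S|) <= (#|S|.-2) * (#|S|.-1).
Proof.
move=> pS qS pq hb; set s := #|S|.
pose n2 := #|transporter p q p q|.
have n2E p' q' P Q : p' != q' -> P != Q -> #|transporter p' q' P Q| = n2.
  by move=> pq' PQ; apply/eqP; rewrite eqn_leq !card_transporter_le.
have n2_gt0 : 0 < n2 by rewrite card_gt0; apply/set0Pn; exists 1; rewrite inE group1 !perm1 !eqxx.
have s_gt0 : 0 < s by rewrite card_gt0; apply/set0Pn; exists p.
have cD : #|S :\ p :\ q| = s.-2.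
  by have := cardsD1 p S; have := cardsD1 q (S :\ p); rewrite !inE pS qS eq_sym pq /= -/s; lia.
pose Wc := [set w in G | (w p \in S) && (w q \in ~: S)].
have cW : #|Wc| = (s * (#|T| - s) * n2)%N.
  by rewrite (@card_transporter_sets p q S (~: S) n2 pq) ?card_setXC // => P Q; apply: n2E.
have : b * #|Wc| <= (s.-2) * (s * s.-1 * n2).
  rewrite mulnC -sum_nat_const.
  apply: (@leq_trans (\sum_(w in Wc) \sum_(x in S :\ p :\ q) (w x \in S))).
    apply: leq_sum => w; rewrite !inE => /andP[Gw /andP[wp wq]].
    rewrite -big_mkcondr sum1_card /=; apply: leq_trans (hb w Gw wp wq) _.
    by apply: subset_leq_card; apply/subsetP => x; rewrite inE => wx; exact: wx.
  rewrite exchange_big -cD -sum_nat_const /=; apply: leq_sum => x.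
  rewrite !inE => /and3P[xq xp xS].
  rewrite -big_mkcondr sum1_card /= -card_offdiag -(@card_transporter_sets p x); first last.
  - by move=> P Q; apply: n2E; rewrite eq_sym.
  - by rewrite eq_sym.
  apply: subset_leq_card; apply/subsetP => w /andP[].
  by rewrite !inE => /andP[-> /andP[-> _]] ->.
rewrite cW => le; rewrite -(@leq_pmul2r (s * n2)) ?muln_gt0 ?s_gt0 //.
by nia.
Qed.

(** The commutator of two permutations whose supports meet in a single point is a
    3-cycle on this point and its two images. *)
Lemma tri_of_overlap1 (h k : {perm T}) p :
  h \in G -> k \in G -> supp h :&: supp k = [set p] -> exists a b c,
  uniq [:: a; b; c] /\ tri G a b c.
Proof.
move=> Gh Gk hk; have [ph pk] : p \in supp h /\ p \in supp k.
  by apply/andP; rewrite -in_setI hk inE.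
have out x : x != p -> x \in supp h -> x \notin supp k.
  by move=> xp xh; apply: contra xp => xk; rewrite -in_set1 -hk inE xh.
have out' x : x != p -> x \in supp k -> x \notin supp h.
  by move=> xp xk; apply: contra xp => xh; rewrite -in_set1 -hk inE xh.
have hp : h p != p by rewrite inE in ph. 
have kp : k p != p by rewrite inE in pk. 
have hph : h p \notin supp k by rewrite out ?supp_in.
have kph : k p \notin supp h by rewrite out' ?supp_in.
have hkp : h p != k p by apply: contraNneq hph => ->; rewrite supp_in.
exists p, (k p), (h p); split; first by rewrite /= !inE !negb_or ![p == _]eq_sym hp kp eq_sym hkp.
rewrite /tri.
suff <- : [~ h, k] = tperm p (k p) * tperm p (h p) by rewrite groupR.
have hV y : y \notin supp h -> h^-1 y = y by rewrite -suppV => /supp_out.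
have kV y : y \notin supp k -> k^-1 y = y by rewrite -suppV => /supp_out.
have hin y : (h^-1 y \in supp h) = (y \in supp h) by rewrite -{1}suppV supp_in suppV.
have kin y : (k^-1 y \in supp k) = (y \in supp k) by rewrite -{1}suppV supp_in suppV.
apply/permP => x; rewrite commgEl conjgE !permM.
have hVp : h^-1 p != p by rewrite (can2_eq (permKV h) (permK h)) eq_sym.
have kVp : k^-1 p != p by rewrite (can2_eq (permKV k) (permK k)) eq_sym.
have [->|xp] := eqVneq x p.
  have ky : k^-1 (h^-1 p) = h^-1 p by apply: kV; rewrite out ?hin.
  by rewrite ky permKV tpermL tpermD // eq_sym.
have [->|xhp] := eqVneq x (h p).
  have hy : h (k^-1 p) = k^-1 p by apply: supp_out; rewrite out' ?kin.
  by rewrite permK hy permKV (tpermD (z := h p)) 1?eq_sym // tpermR.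
have [->|xkp] := eqVneq x (k p).
  by rewrite tpermR tpermL (hV _ kph) permK (supp_out hph).
rewrite !tpermD 1?eq_sym //.
have : x \notin supp [~ h, k].
  apply/negP => /(subsetP (supp_comm h k)); rewrite hk !imset_set1 !inE.
  by rewrite (negPf xp) (negPf xhp) (negPf xkp).
by move/supp_out; rewrite commgEl conjgE !permM.
Qed.

(** Take [g] nontrivial of minimal support [S] and [p] in [S].  When [w] sends [p]
    into [S] and [g p] out of it, [g] does not commute with its conjugate by the
    inverse of [w], and the support of their commutator is at most three times the
    overlap of their supports.  If the overlap is never a single point, minimality
    makes it at least |S|/3 for all such [w], and this contradicts the mean value
    of [mean_overlap] since |S| is small. *)
Theorem small_support_tri (h : {perm T}) :
  h \in G -> h != 1 -> 8 * #|supp h| <= #|T| ->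
  exists a b c, uniq [:: a; b; c] /\ tri G a b c.
Proof.
move=> Gh h1 small.
have Ph : (h \in G) && (h != 1) by rewrite Gh.
case: (@arg_minnP _ h (fun g => (g \in G) && (g != 1)) 
  (fun g => #|supp g|) Ph) => g /andP[Gg g1] gmin.
have {}small : 8 * #|supp g| <= #|T|.
  by apply: leq_trans small; rewrite leq_mul2l gmin ?Ph.
set S := supp g in small *.
have [p pS] : exists p, p \in S.
  apply/set0Pn; apply: contraNneq g1 => S0; apply/eqP/permP => x.
  by rewrite perm1 supp_out // -/S S0 inE.
have qS : g p \in S by rewrite supp_in.
have pq : p != g p by rewrite eq_sym; rewrite inE in pS.
have s2 : 2 <= #|S|.
  by have := cardsD1 p S; have := cardsD1 (g p) (S :\ p); rewrite in_setD1 pS qS eq_sym pq /=; lia.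
pose D (w : {perm T}) := [set x in S :\ p :\ g p | w x \in S].
have DE w x : (x \in D w) = [&& x != g p, x != p, x \in S & w x \in S].
  by rewrite [LHS]in_set /= !in_setD1 -!andbA.
pose beta w := #|D w|.
have ov := mean_overlap pS qS pq.
have overlap w : w \in G -> w p \in S -> w (g p) \notin S ->
    supp g :&: supp (g ^ w^-1) = p |: D w.
  move=> Gw wp wq; apply/setP => x; rewrite suppJ invgK in_setI in_setU1 DE.
  rewrite (in_set (fun x => w x \in supp g)) -/S.
  have [->|xp] := eqVneq x p; first by rewrite pS.
  by have [->|xq] := eqVneq x (g p); rewrite ?(negPf wq) ?andbF.
have [/exists_inP[w Gw /and3P[wp wq /eqP b0]]|/exists_inPn no] :=
  boolP [exists w in G, [&& w p \in S, w (g p) \notin S & beta w == 0%N]].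
  apply: (@tri_of_overlap1 g (g ^ w^-1) p) => //; first by rewrite groupJ ?groupV.
  by rewrite overlap // (cards0_eq b0) setU0.
have bpos w : w \in G -> w p \in S -> w (g p) \notin S -> 0 < beta w.
  by move=> Gw wp wq; have := no w Gw; rewrite wp wq lt0n.
have ov1 := ov 1%N bpos.
(* The overlap has [beta w + 1] points, hence the predecessor of |S| here. *)
have bdiv w : w \in G -> w p \in S -> w (g p) \notin S -> (#|S|.-1 %/ 3) <= beta w.
  move=> Gw wp wq; set k := g ^ w^-1.
  have cB : #|supp g :&: supp k| = (beta w).+1.
    by rewrite overlap // cardsU1 DE eqxx andbF.
  have C1 : (([~ g, k] \in G) && ([~ g, k] != 1)).
    rewrite groupR ?groupJ ?groupV //=; apply/commgP => cgk.
    have pk : p \in supp k by rewrite suppJ invgK in_set.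
    have qk : g p \notin supp k by rewrite suppJ invgK in_set.
    have : (g * k) p = (k * g) p by rewrite cgk.
    rewrite permM [RHS]permM (supp_out qk) => /perm_inj pkp.
    by move: pk; rewrite inE -pkp eqxx.
  have := leq_trans (gmin _ C1) (card_supp_comm g k).
  by rewrite cB -/S; move: #|S| (beta w) => s b; clear; lia.
have ov3 := ov _ bdiv.
move: small ov1 ov3 s2; rewrite -/S; move: #|S| #|T| => s N small ov1 ov3 s2.
clear - small ov1 ov3 s2; exfalso.
have hN : 7 * s <= N - s by lia.
have [s3|s4] := leqP s 3.
  have l1 : s.-2 <= 1 by lia.
  have l2 : s.-1 <= 2 by lia.
  by have := leq_mul l1 l2; lia.
have hb : s - 3 <= 3 * (s.-1 %/ 3) by lia.
have [t st] : exists t, s = t + 4 by exists (s - 4)%N; lia.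
have := leq_mul hb hN; rewrite -mulnA; move: (_ %/ _ * _)%N ov3 => Z ov3 hZ.
have e2 : s.-2 = t + 2 by lia.
have e1 : s.-1 = t + 3 by lia.
have e3 : s - 3 = t + 1 by lia.
rewrite e2 e1 in ov3; rewrite e3 st in hZ; nia.
Qed.

End MinDegree.

(** * Gates of small support *)

Section Shrink.
Variables (A : finType) (G : gate_clone A).
Hypothesis A5 : 5 <= #|A|.

(** On one line of direction [z], one point is fixed while the wire [z] changes at
    another.  This is what makes the commutator in [commg_shrink] move the shared
    wire again, so that the construction can be repeated. *)
Definition pivot n (k : {perm 'rV[A]_n}) z := exists q c d,
  [/\ c != d, k (upd z c q) = upd z c q & k (upd z d q) ord0 z != d].

(** Take two points of a line, with letters [y1] and [c] at [y], whose images under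
    [h] have letters [y2] and [c'] different from [y1], and let [v] exchange [y1]
    at [y] with a letter [e] different from all four.  Then [v] fixes both images
    and the second point, and only moves the first, so the commutator of [h] and
    [v] fixes the second point and turns the letter of the first into [e].  Five
    letters suffice for [e] to exist. *)
Lemma pivot_of_seed : seed G -> exists m (z : 'I_m) k,
  [/\ k \in G m, exists x0, inert k z x0 & pivot k z].
Proof.
move=> [n [y [h [Gh [x0 /inertP h0] [q hq]]]]].
(* Start from the moved point; if its letter [b0] is the letter at [y] of the image
   of every other point of the line, start from one of these instead. *)
have [c [y1 [cy1 hy1 hc]]] : exists c y1, [/\ c != y1, h (upd y y1 q) ord0 y != y1 &
    h (upd y c q) ord0 y != y1].
  pose b0 := q ord0 y; have hb0 : h (upd y b0 q) ord0 y != b0 by rewrite upd_id.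
  have [[c [cb0 hc]]|no] := pselect (exists c, c != b0 /\ h (upd y c q) ord0 y != b0).
    by exists c, b0.
  have hb c : c != b0 -> h (upd y c q) ord0 y = b0.
    by move=> cb0; apply/eqP/negP => /negP hc; apply: no; exists c.
  have [|c1 c1b] := @fresh A [:: b0]; first by apply: leq_trans A5.
  have [|c2 c2b] := @fresh A [:: b0; c1]; first by apply: leq_trans A5.
  rewrite !inE in c1b c2b; move: c2b; rewrite negb_or => /andP[c2b c21].
  by exists c2, c1; split=> //; rewrite hb // eq_sym.
set y2 := h (upd y y1 q) ord0 y in hy1; set c' := h (upd y c q) ord0 y in hc.
have [e] := @fresh A [:: y1; y2; c; c'] A5.
rewrite !inE !negb_or => /and4P[ey1 ey2 ec ec'].
pose v := at_wire y (tperm y1 e).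
have vid (x : 'rV[A]_n) : x ord0 y != y1 -> x ord0 y != e -> v x = x.
  by move=> x1 xe; rewrite at_wireE tpermD 1?eq_sym // upd_id.
have hV0 b : h^-1 (upd y b x0) = upd y b x0 by rewrite -{1}(h0 b) permK.
exists n, y, (h * v * h^-1 * v^-1); split.
- by rewrite !groupM ?groupV ?clone_at_wire.
- exists x0; apply/inertP => b; rewrite !permM h0.
  by rewrite at_wire_upd hV0 -at_wire_upd permK.
- have vV : v^-1 = v by rewrite at_wireV tpermV.
  have vc : v (h (upd y c q)) = h (upd y c q) by apply: vid; rewrite // eq_sym.
  have v1 : v (h (upd y y1 q)) = h (upd y y1 q) by apply: vid; rewrite // eq_sym.
  exists q, c, y1; split=> //; rewrite !permM vV ?vc ?v1 permK at_wire_upd.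
    by rewrite tpermD // eq_sym.
  by rewrite tpermL upd_in.
Qed.

Definition noninert n (g : {perm 'rV[A]_n}) y := [set x | ~~ inert g y x].

Lemma supp_noninert n (g : {perm 'rV[A]_n}) y : supp g \subset noninert g y.
Proof.
apply/subsetP => x; rewrite !inE; apply: contra => /inertP/(_ (x ord0 y)).
by rewrite upd_id => ->.
Qed.

Lemma inert_upd n (g : {perm 'rV[A]_n}) y b x : inert g y (upd y b x) = inert g y x.
Proof. by apply: eq_forallb => c; rewrite upd_upd. Qed.

Lemma comm_fix (T : finType) (Z : {set T}) (s t : {perm T}) :
  (forall x, x \in Z -> s x = x) -> (forall x, x \in Z -> t^-1 x \in Z) ->
  forall x, x \in Z -> [~ s, t] x = x.
Proof.
move=> sZ tZ x xZ; have sVZ y : y \in Z -> s^-1 y = y by move=> yZ; rewrite -{1}(sZ y yZ) permK.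
by rewrite commgEl conjgE !permM sVZ // sZ ?permKV // tZ.
Qed.

(** The two gates share the wire [y] only.  A line in this direction is a pair of
    configurations of the other wires; if [g] fixes the line given by the first
    component, then it fixes all the points that the second gate can reach from
    there, so the commutator is trivial on the line; and symmetrically.  Hence the
    lines with a moved point lie in a product.

    The commutator moves [y] because the letters of the pivot are renamed to those
    of a point [q1] and of its image: the second gate then fixes the configuration
    before [g] acts on it and changes [y] afterwards. *)
Lemma commg_shrink n (y : 'I_n) (g : {perm 'rV[A]_n}) m (z : 'I_m) (k : {perm 'rV[A]_m}) :
  g \in G n -> moves_wire g y -> k \in G m -> pivot k z ->
  exists2 C, C \in G (n + m)%N & moves_wire C (lshift m y) /\
    #|noninert C (lshift m y)| <= #|noninert g y| * #|noninert k z|.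
Proof.
move=> Gg [q1 gq1] Gk [q [c [d [cd kc kd]]]].
(* The wire [rshift n z] is left idle, so that no arity arithmetic is needed. *)
pose e2 (j : 'I_m) : 'I_(n + m) := if j == z then lshift m y else rshift n j.
have e2_inj : injective e2.
  move=> i j; rewrite /e2; case: (eqVneq i z) => [->|_]; case: (eqVneq j z) => [->|_] //.
  - by move/eqP; rewrite eq_lrshift.
  - by move/eqP; rewrite eq_rlshift.
  - exact: rshift_inj.
have [v [vc vd]] : exists v : {perm A}, v c = q1 ord0 y /\ v d = g q1 ord0 y.
  have [|||v [vc vd]] := @perm_map_uniq _ [:: c; d] [:: q1 ord0 y; g q1 ord0 y] => //.
  - by rewrite /= inE cd.
  - by rewrite /= inE eq_sym gq1.
  by exists v.
pose k1 := k ^ at_wire z v.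
have k1c : k1 (upd z (q1 ord0 y) q) = upd z (q1 ord0 y) q.
  by rewrite /k1 conjgE !permM at_wireV at_wire_upd -vc permK kc at_wire_upd.
have k1d : k1 (upd z (g q1 ord0 y) q) ord0 z != g q1 ord0 y.
  by rewrite /k1 conjgE !permM at_wireV at_wire_upd -vd permK at_wire_in (inj_eq perm_inj).
pose G1 := ext (@lshift_inj n m) g; pose K1 := ext e2_inj k1.
have sub2 (x : 'rV[A]_n) (x' : 'rV[A]_m) : sub e2 (row_mx x x') = upd z (x ord0 y) x'.
  by apply: row_eqP => j; rewrite !rowfE /e2; case: eqP; rewrite ?row_mxEl ?row_mxEr.
have G1E (x : 'rV[A]_n) (x' : 'rV[A]_m) : G1 (row_mx x x') = row_mx (g x) x'.
  by apply: ext_lshift_row_mx.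
exists [~ G1, K1].
  by rewrite groupR ?clone_ext // groupJ ?clone_at_wire.
split.
  exists (row_mx (g q1) q).
  have K1q : K1^-1 (row_mx q1 q) = row_mx q1 q.
    apply: (canLR (permK K1)); rewrite extE sub2 k1c -(sub2 q1) ins_sub //.
  have G1q : G1^-1 (row_mx (g q1) q) = row_mx q1 q by apply: (canLR (permK G1)); rewrite G1E.
  rewrite commgEl conjgE !permM G1q K1q G1E row_mxEl.
  have {1}-> : lshift m y = e2 z by rewrite /e2 eqxx.
  by rewrite ext_in sub2.
pose Z1 := [set X : 'rV[A]_(n + m) | inert g y (lsubmx X)].
pose Z2 := [set X : 'rV[A]_(n + m) | inert k z (rsubmx X)].
have lsub_upd b (X : 'rV[A]_(n + m)) : lsubmx (upd (lshift m y) b X) = upd y b (lsubmx X).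
  by apply: row_eqP => j; rewrite !mxE eq_lshift.
have rsub_upd b (X : 'rV[A]_(n + m)) : rsubmx (upd (lshift m y) b X) = rsubmx X.
  by apply: row_eqP => j; rewrite !mxE eq_rlshift.
have fix1 X : X \in Z1 -> G1 X = X.
  rewrite inE => /inertP/(_ (lsubmx X ord0 y)); rewrite upd_id => gX.
  by rewrite -{1}(hsubmxK X) G1E gX hsubmxK.
have k1_inert x : inert k z x -> inert k1 z x.
  move=> /inertP kx; apply/inertP => b.
  by rewrite /k1 conjgE !permM at_wireV at_wire_upd kx at_wire_upd permKV.
have fix2 X : X \in Z2 -> K1 X = X.
  rewrite inE => /k1_inert/inertP kX; rewrite extE -{2}(hsubmxK X) sub2 kX.
  by rewrite -(sub2 (lsubmx X)) hsubmxK ins_sub.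
have pres1 X : X \in Z1 -> K1^-1 X \in Z1.
  rewrite !inE -extV; set k2 := k1^-1 => iX.
  rewrite -(inert_upd _ _ (lsubmx X ord0 y)).
  suff -> : upd y (lsubmx X ord0 y) (lsubmx (ext e2_inj k2 X)) = lsubmx X by [].
  apply: row_eqP => j; have [->|jy] := eqVneq j y; first by rewrite upd_in.
  rewrite upd_out // !mxE ext_out // => i; rewrite /e2; case: ifP => _.
    by rewrite eq_lshift eq_sym.
  by rewrite eq_rlshift.
have pres2 X : X \in Z2 -> G1^-1 X \in Z2.
  rewrite !inE => iX; suff -> : rsubmx ((G1^-1)%g X) = rsubmx X by [].
  by rewrite -extV -{1}(hsubmxK X) ext_lshift_row_mx row_mxKr.
have Cfix X : X \in Z1 :|: Z2 -> [~ G1, K1] X = X.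
  rewrite in_setU => /orP[XZ|XZ]; first exact: (comm_fix fix1 pres1).
  by rewrite -invg_comm; apply: (canLR (permK _)); rewrite (comm_fix fix2 pres2).
have ZU b X : X \in Z1 :|: Z2 -> upd (lshift m y) b X \in Z1 :|: Z2.
  by rewrite !inE lsub_upd rsub_upd inert_upd.
have split_inj : injective (fun X : 'rV[A]_(n + m) => (lsubmx X, rsubmx X)).
  by move=> X Y [eL eR]; rewrite -(hsubmxK X) eL eR hsubmxK.
rewrite -cardsX -(card_imset _ split_inj).
apply: subset_leq_card; apply/subsetP => _ /imsetP[X XC ->].
have XZ : X \notin Z1 :|: Z2.
  move: XC; rewrite inE; apply: contra => XZ; apply/inertP => b.
  by apply: Cfix; apply: ZU.
by move: XZ; rewrite !inE negb_or.
Qed.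

(** By Bernoulli, (1 + 1/c)^r is at least 1 + r/c. *)
Lemma geometric_decay c b r : c < b -> 7 * c <= r -> 0 < r -> 8 * c ^ r <= b ^ r.
Proof.
move=> cb r7 r0; case: (posnP c) => [->|c0]; first by rewrite exp0n.
have bern s : (c + s) * c ^ s <= c * b ^ s.
  elim: s => [|s IHs]; first by rewrite !expn0 !muln1 addn0.
  have h := leq_mul IHs cb; rewrite !expnSr !mulnA; apply: leq_trans h.
  by move: (c ^ s)%N => u; nia.
rewrite -(leq_pmul2l c0); apply: leq_trans (bern r).
by rewrite mulnA; apply: leq_mul => //; lia.
Qed.

Lemma iterated_shrink m (z : 'I_m) (k : {perm 'rV[A]_m}) r :
  k \in G m -> pivot k z -> exists n (y : 'I_n) (g : {perm 'rV[A]_n}),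
    [/\ r < n, g \in G n, moves_wire g y &
    #|noninert g y| * (#|A| ^ m) ^ r.+1 <= #|noninert k z| ^ r.+1 * #|A| ^ n].
Proof.
move=> Gk pk; elim: r => [|r [n [y [g [rn Gg my le]]]]].
  exists m, z, k; rewrite !expn1; split=> //; first exact: leq_ltn_trans (ltn_ord z).
  have [q [c [d [_ _ kd]]]] := pk.
  by exists (upd z d q); rewrite upd_in.
have [C GC [mC leC]] := commg_shrink Gg my Gk pk.
exists (n + m)%N, (lshift m y), C; split=> //; first by have := ltn_ord z; lia.
apply: leq_trans (leq_mul leC (leqnn _)) _.
have := leq_mul le (leqnn (#|noninert k z| * #|A| ^ m)).
by rewrite expnD !(expnSr _ r.+1); move: (_ ^ r.+1)%N (_ ^ r.+1)%N => u v; nia.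
Qed.

Theorem small_support_gates N : seed G -> exists n (g : {perm 'rV[A]_n}),
  [/\ N < n, g \in G n, g != 1 & 8 * #|supp g| <= #|{: 'rV[A]_n}|].
Proof.
move=> /pivot_of_seed[m [z [k [Gk [x0 k0] pk]]]].
set c := #|noninert k z|; pose r := (N + 7 * c)%N.
have [n [y [g [rn Gg my le]]]] := iterated_shrink r Gk pk.
exists n, g; split=> //; first by move: rn; rewrite /r; lia.
  by case: my => q; apply: contraNneq => ->; rewrite perm1.
have cb : c < #|A| ^ m.
  rewrite -[m]mul1n -card_mx /c -[#|{: _}|]cardsT; apply: proper_card.
  by apply/properP; split; [apply: subsetT | exists x0; rewrite !inE ?k0].
have b0 : 0 < (#|A| ^ m) ^ r.+1 by rewrite !expn_gt0; apply/orP; left; lia.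
rewrite card_mx mul1n -(leq_pmul2r b0).
have decay : 8 * c ^ r.+1 <= (#|A| ^ m) ^ r.+1 by apply: geometric_decay; rewrite // /r; lia.
have le1 := leq_mul (leqnn 8)
  (leq_mul (subset_leq_card (supp_noninert g y)) (leqnn ((#|A| ^ m) ^ r.+1))).
have le2 := leq_mul (leqnn 8) le.
have le3 := leq_mul decay (leqnn (#|A| ^ n)).
rewrite -mulnA; apply: leq_trans le1 _; apply: leq_trans le2 _.
by rewrite mulnA [X in _ <= X]mulnC.
Qed.

End Shrink.

(** * Parity of padded gates *)

(** Remove the transpositions of the involution one at a time. *)
Lemma odd_involution (T : finType) (s : {perm T}) k :
  s * s = 1 -> #|supp s| = k.*2 -> odd_perm s = odd k.
Proof.
elim: k s => [|k IHk] s ss sk.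
  have -> : s = 1.
    by apply/permP => x; rewrite perm1 supp_out // (cards0_eq sk) inE.
  by rewrite odd_perm1.
have ssx x : s (s x) = x by rewrite -permM ss perm1.
have /card_gt0P[x xs] : 0 < #|supp s| by rewrite sk.
have xsx : x != s x by rewrite eq_sym; rewrite inE in xs.
pose t := tperm x (s x) * s.
have tE z : t z = if (z == x) || (z == s x) then z else s z.
  rewrite permM; case: tpermP => [->|->|/eqP/negPf -> /eqP/negPf -> //].
    by rewrite eqxx ssx.
  by rewrite eqxx orbT.
have suppt : supp t = supp s :\ x :\ s x.
  apply/setP => z; rewrite !in_setD1 !inE tE.
  by case: (z == x); case: (z == s x); rewrite /= ?eqxx.
have tt : t * t = 1.
  apply/permP => z; rewrite perm1 permM (tE z); case: ifP => [h|/norP[zx zsx]].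
    by rewrite tE h.
  rewrite tE (can2_eq ssx ssx) (negPf zsx) (inj_eq perm_inj) (negPf zx) /=; exact: ssx.
have : #|supp t| = k.*2.
  have := cardsD1 x (supp s); have := cardsD1 (s x) (supp s :\ x).
  by rewrite suppt in_setD1 supp_in xs eq_sym xsx sk /=; lia.
by move/(IHk _ tt); rewrite odd_mul_tperm xsx /= => <-; rewrite negbK.
Qed.

Section Parity.
Variables (A : finType) (k n : nat) (e : 'I_k -> 'I_n) (e_inj : injective e).
Hypothesis A_gt0 : 0 < #|A|.

(** Overwriting the wires of [e] identifies A^n with the product of any fiber and
    A^k. *)
Lemma card_fiber (p : 'rV[A]_k) : #|[set x | sub e x == p]| = (#|A| ^ (n - k))%N.
Proof.
have kn : k <= n by rewrite -[k]card_ord -[n]card_ord (leq_card _ e_inj).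
have h_inj : injective (fun X : 'rV[A]_n => (ins e X p, sub e X)).
  move=> X Y [e1 e2]; have := congr1 (fun Z => ins e Z (sub e X)) e1.
  by rewrite !ins_ins // {2}e2 !ins_sub.
have : #|setX [set x | sub e x == p] [set: 'rV[A]_k]| = #|[set: 'rV[A]_n]|.
  rewrite -(card_imset _ h_inj); apply: eq_card => -[x z]; rewrite !inE andbT /=.
  apply/eqP/imsetP => [xp|[X _ [-> _]]]; last by rewrite sub_ins.
  by exists (ins e x z); rewrite ?inE // ins_ins // sub_ins // -xp ins_sub.
rewrite cardsX !cardsT !card_mx !mul1n.
have -> : (#|A| ^ n = #|A| ^ (n - k) * #|A| ^ k)%N by rewrite -expnD subnK.
move/eqP.
by rewrite eqn_pmul2r ?expn_gt0 ?A_gt0 // => /eqP.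
Qed.

(** A transposition becomes a product of as many disjoint transpositions as there
    are configurations of the other wires. *)
Lemma odd_ext (g : {perm 'rV[A]_k}) : odd_perm (ext e_inj g) = odd (#|A| ^ (n - k)) && odd_perm g.
Proof.
have odd_ext_tperm (p q : 'rV[A]_k) : p != q ->
    odd_perm (ext e_inj (tperm p q)) = odd (#|A| ^ (n - k)).
  move=> pq; apply: odd_involution; first by rewrite -extM tperm2 ext1.
  have -> : supp (ext e_inj (tperm p q)) = [set x | sub e x == p] :|: [set x | sub e x == q].
    apply/setP => x; rewrite !inE extE.
    have -> : (ins e x (tperm p q (sub e x)) == x) = (tperm p q (sub e x) == sub e x).
      apply/eqP/eqP => [h|->]; last exact: ins_sub.
      by rewrite -{2}h sub_ins.
    case: tpermP => [->|->|/eqP/negPf -> /eqP/negPf ->]; rewrite ?eqxx ?orbT ?pq //.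
    by rewrite eq_sym pq.
  rewrite cardsU !card_fiber; suff -> : [set x | sub e x == p] :&: [set x | sub e x == q] = set0.
    by rewrite cards0 subn0 addnn.
  by apply/setP => x; rewrite !inE; case: eqP => // ->; apply: negbTE.
have [ts -> dts] := prod_tpermP g; elim: ts dts => [_|t ts IHts /andP[dt /IHts IH]].
  by rewrite big_nil ext1 !odd_perm1 andbF.
have tt : t.1 != t.2 := dt.
rewrite big_cons extM !odd_permM IH odd_ext_tperm // odd_tperm tt.
by case: (odd _) => //; case: (odd_perm _).
Qed.

End Parity.

(** * Maximality *)

Section Borrow.
Variable A : finType.

(** One wire at a time, since borrow closedness removes a single wire. *)
Lemma borrow_pad (C : set (gate A)) n (f : Bn A n) d : borrow_closed C -> 0 < n ->
  C (Gate (pad (leq_addr d n) f)) -> C (Gate f).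
Proof.
move=> bC n0; elim: d => [|d IHd].
  by rewrite (Gate_pad_irr _ (leqnn n) f (addn0 n)) pad_nn.
have le : n <= n + d + 1 by lia.
rewrite (Gate_pad_irr _ le f); last by lia.
have -> : pad le f = par (pad (leq_addr d n) f) (id_gate A 1).
  rewrite par_id_ext !pad_ext; apply: ext_ext => j; exact: val_inj.
by move/bC => h; apply: IHd; apply: h; lia.
Qed.

Hypothesis A5 : 5 <= #|A|.

(** Let [n + d.+1] be an arity at which all even permutations are available.  The
    padding [F] of the given gate to this arity can be odd only when |A| is odd, and
    then a padded unary transposition is odd too and corrects the parity. *)
Theorem borrow_closed_above_Deg (C : set (gate A)) :
  is_RTA C -> borrow_closed C -> (Deg A `<` C)%classic -> (Ball A `<=` C)%classic.
Proof.
move=> rC bC [DC nCD].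
have [[n0 f] [Cf nDf]] : exists f, C f /\ ~ Deg A f.
  by apply: contrapT => no; apply: nCD => f Cf; apply: contrapT => nD; apply: no; exists f.
have n0_gt0 : 0 < n0 by case: rC => CB _ _ _; apply: (CB _ Cf).
have A2 : 2 <= #|A| by lia.
have nd : ~ degenerate f by move=> df; apply: nDf; apply/Deg_E.
have C1 : (Barity A 1 `<=` C)%classic by move=> g /Deg_arity1; apply: DC.
pose G := RTA_clone rC C1.
have Gf : f \in G n0 by apply/RTA_setP.
have [N trN] := two_transitive A5 Gf nd.
move=> [n g] /= n_gt0.
have [m [s [Nm Gs s1 small]]] := small_support_gates A5 (N + n) (seed_of_nondegenerate A5 Gf nd).
have [d md] : exists d, m = (n + d.+1)%N by exists (m - n.+1)%N; lia.
subst m; have {}trN := trN (n + d.+1)%N ltac:(lia).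
have [a [b [c [abc Gabc]]]] := small_support_tri trN Gs s1 small.
have even := tri_even trN abc Gabc.
apply: (borrow_pad (d := d.+1) bC n_gt0).
have nd_gt0 : 0 < n + d.+1 by lia.
apply/(RTA_setP C _ nd_gt0); rewrite pad_ext -[RTA_set _ _]/(gval (G _)).
set F := ext _ g.
have [oddF|] := boolP (odd_perm F); last exact: even.
have A_gt0 : 0 < #|A| by lia.
have oddA : odd #|A|.
  move: oddF; rewrite /F odd_ext // => /andP[+ _].
  by rewrite oddX; have -> : (n + d.+1 - n == 0)%N = false by lia.
have [a0 _] : exists a0 : A, true by case/card_gt0P: A_gt0 => a0 _; exists a0.
have [b0 ba] := other A2 a0.
pose t : Bn A 1 := tperm (rowf (fun _ => a0)) (rowf (fun _ => b0)).
have Gt : ext (const_inj (Ordinal nd_gt0)) t \in G (n + d.+1)%N.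
  by apply: clone_ext; apply/RTA_setP => //; apply: (C1).
have odd_t : odd_perm (ext (const_inj (Ordinal nd_gt0)) t).
  rewrite odd_ext // oddX oddA orbT odd_tperm /=.
  by apply: contraNneq ba => /(congr1 (fun x : 'rV[A]_1 => x ord0 ord0)); rewrite !rowfE => ->.
rewrite -[F](mulgK (ext (const_inj (Ordinal nd_gt0)) t)) groupM ?groupV //.
by apply: even; rewrite odd_permM oddF odd_t.
Qed.

End Borrow.

Theorem lemma11 (A : finType) (hA : 5 <= #|A|) :
  maximal_borrow_closed_RTA (Deg A) /\ maximal_ancilla_closed_RTA (Deg A).
Proof.
have A2 : 2 <= #|A| by lia.
have no_between N : is_RTA N -> borrow_closed N -> (Deg A `<` N)%classic ->
    ~ (N `<` Ball A)%classic.
  by move=> rN bN DN [_]; apply; apply: borrow_closed_above_Deg.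
have ancD := Deg_ancilla A2.
split; split=> //; try exact: Deg_RTA; try exact: Deg_proper.
- exact: ancilla_borrow.
- by move=> [N [rN bN DN NB]]; apply: (no_between N).
- by move=> [N [rN /(ancilla_borrow A2) bN DN NB]]; apply: (no_between N).
Qed.
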